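(* Let $\alpha>1$. For each $n\ge2$ let $\xi_1,\dots,\xi_n$ be i.i.d. Uniform$([0,1])$ and, for $W\in\mathcal W(\alpha)$, let $M$ be the $n\times n$ probability matrix $M_{ij}=W(\xi_i,\xi_j)\mathbf 1(i\neq j)$ and $A$ the random adjacency matrix generated from $M$. Then there is a constant $c>0$ not depending on $n$ such that for all $n\ge 2$ $$\inf_{\widehat M}\ \sup_{W\in\mathcal W(\alpha)}\ \frac1{n^2}E\left[\|\widehat M-M\|_F^2\right]\ \ge\ c\,(n\log n)^{-\frac{2\alpha-1}{2\alpha}},$$ where the infimum is over all estimators $\widehat M=\widehat M(A)$ (measurable functions of $A$ with values in $\mathbb R^{n\times n}$) and the expectation is over $\xi_1,\dots,\xi_n$ and $A$.
   Context: A graphon is a symmetric measurable function $W:[0,1]\times[0,1]\to[0,1]$. It defines the compact symmetric operator $(T_WX)(v)=\int_0^1W(u,v)X(u)\,du$ on $L_2([0,1])$, with eigenvalues $\omega_1,\omega_2,\dots$ (ordered so that $|\omega_1|\ge|\omega_2|\ge\cdots$) and a corresponding orthonormal basis of eigenfunctions $\varphi_1,\varphi_2,\dots$ of $L_2([0,1])$, so that $W(x,y)=\sum_i\omega_i\varphi_i(x)\varphi_i(y)$ in $L_2$. Standing assumptions: all graphons are trace-class, i.e. $\sum_i|\omega_i|<\infty$, and (after modification on a null set) the identity $W(x,y)=\sum_i\omega_i\varphi_i(x)\varphi_i(y)$ is taken to hold everywhere. $W$ has polynomial spectral decay with rate $\alpha$ if $|\omega_k|\le Ck^{-\alpha}$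 for all $k$, where $C>0$ is a fixed constant. $\mathcal W(\alpha)$ is the set of graphons with polynomial spectral decay with rate $\alpha$ for which the partial sums of the diagonal $\sum_{i=1}^k\omega_i\varphi_i^2(x)$ converge to $W(x,x)$ in $L_2([0,1])$ as $k\to\infty$. Adjacency matrix: given $M$, $A$ is symmetric with zero diagonal and, for $1\le i<j\le n$, the entries $A_{ij}\sim\text{Bernoulli}(M_{ij})$ are independent. $\|\cdot\|_F$ is the Frobenius norm. *)

(* Defs.v *)
From HB Require Import structures.
From mathcomp Require Import all_boot all_order all_algebra.
From mathcomp Require Import all_classical all_reals all_analysis.
Import Order.TTheory GRing.Theory Num.Theory.
Import numFieldNormedType.Exports.

Set Implicit Arguments.
Unset Strict Implicit.
Unset Printing Implicit Defensive.

Local Open Scope classical_set_scope.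
Local Open Scope ring_scope.

(* Functions on [0,1] and on [0,1]^2 are represented by functions on R and
   R * R; every definition below only constrains their values on the unit
   interval or square. *)
Definition unit_itv (R : realType) : set R := `[0, 1].
Arguments unit_itv {R}.

Section L2.
Variable R : realType.
Implicit Types (f g : R -> R) (B : set (R -> R)).
Local Notation mu := (@lebesgue_measure R).

Definition square_integrable f :=
  measurable_fun unit_itv f /\ mu.-integrable unit_itv (fun x => (f x ^+ 2)%:E).

Definition inner f g : R := \int[mu]_(x in unit_itv) (f x * g x).

(* B ranges over sets of functions, not of classes modulo a.e. equality: two
   members of B that agree a.e. on [0,1] would have inner product 1, so
   orthonormality makes them equal. Since L_2([0,1]) is separable, B is at most
   countable. *)
Definition orthonormal_basis B :=
  [/\ B `<=` square_integrable,
      forall f, B f -> inner f f = 1,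
      forall f g, B f -> B g -> f <> g -> inner f g = 0
    & forall f, square_integrable f -> (forall g, B g -> inner f g = 0) ->
        {ae mu, forall x, unit_itv x -> f x = 0}].

End L2.

Section graphons.
Variable R : realType.
Implicit Types (W : R -> R -> R) (omega : nat -> R) (phi : nat -> R -> R).
Local Notation mu := (@lebesgue_measure R).

Definition graphon W :=
  [/\ measurable_fun (unit_itv `*` unit_itv) (fun p : R * R => W p.1 p.2),
      forall x y, unit_itv x -> unit_itv y -> 0 <= W x y <= 1
    & forall x y, unit_itv x -> unit_itv y -> W x y = W y x].

Definition graphon_op W (X : R -> R) (v : R) : R :=
  \int[mu]_(u in unit_itv) (W u v * X u).

Definition eigenfunction W (w : R) (X : R -> R) :=
  {ae mu, forall v, unit_itv v -> graphon_op W X v = w * X v}.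

(* B is an orthonormal basis of eigenfunctions, and (omega i, phi i) lists
   eigenpairs from it with |omega| nonincreasing. The members of B left out of
   the list all belong to the kernel: if infinitely many eigenvalues are
   nonzero, a list with |omega| nonincreasing cannot contain the eigenvalue 0.
   Indices start at 0. *)
Definition spectral_decomposition W omega phi :=
  (forall i, `|omega i.+1| <= `|omega i|) /\
  exists B : set (R -> R),
    [/\ orthonormal_basis B,
        forall i, B (phi i),
        injective phi,
        forall i, eigenfunction W (omega i) (phi i)
      & forall f, B f -> (forall i, f <> phi i) -> eigenfunction W 0 f].

Definition trace_class omega := cvgn (series (fun i => `|omega i|)).

Definition pointwise_expansion W omega phi :=
  forall x y, unit_itv x -> unit_itv y ->
    \sum_(i < k) omega i * phi i x * phi i y @[k --> \oo] --> W x y.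

(* The exponent base is k.+1 because omega 0 is the first eigenvalue. *)
Definition polynomial_decay (C alpha : R) omega :=
  forall k, `|omega k| <= C * k.+1%:R `^ (- alpha).

Definition diagonal_L2_cvg W omega phi :=
  (\int[mu]_(x in unit_itv)
     ((\sum_(i < k) omega i * phi i x ^+ 2 - W x x) ^+ 2)%:E
   @[k --> \oo] --> 0)%E.

Definition graphon_class (C alpha : R) : set (R -> R -> R) :=
  [set W | graphon W /\ exists omega phi,
    [/\ spectral_decomposition W omega phi,
        trace_class omega,
        pointwise_expansion W omega phi,
        polynomial_decay C alpha omega
      & diagonal_L2_cvg W omega phi]].

End graphons.

Section sampling.
Context d (T : measurableType d) (R : realType) (P : probability T R) (n : nat).
Implicit Types (xi : 'I_n -> {RV P >-> R}) (M : T -> 'M[R]_n)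
  (A : T -> 'M[bool]_n) (a : 'M[bool]_n).

(* Subfamilies are covered by taking some of the U i to be setT. *)
Definition mutually_independent xi :=
  forall U : 'I_n -> set R, (forall i, measurable (U i)) ->
    fine (P (\bigcap_(i in [set: 'I_n]) xi i @^-1` U i)) =
    \prod_(i < n) fine (P (xi i @^-1` U i)).

Definition iid_uniform01 xi :=
  [/\ forall i t, unit_itv (xi i t),
      forall i (U : set R), measurable U ->
        distribution P (xi i) U = uniform_prob (@ltr01 R) U
    & mutually_independent xi].

Definition prob_matrix (W : R -> R -> R) xi (t : T) : 'M[R]_n :=
  \matrix_(i, j) (if i != j then W (xi i t) (xi j t) else 0).

Definition sigma_matrix M : set (set T) :=
  <<s \bigcup_(p in [set: 'I_n * 'I_n])
        preimage_set_system setT (fun t => M t p.1 p.2) measurable >>.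

Definition adjacency_matrix a := a^T = a /\ forall i, a i i = false.

(* The last clause says that, conditionally on M, the entries of A above the
   diagonal are independent with A i j ~ Bernoulli(M i j): the product is a
   version of the conditional probability of A = a given the sigma-algebra
   generated by M. *)
Definition generated_adjacency M A :=
  [/\ forall t, adjacency_matrix (A t),
      forall a, measurable [set t | A t = a]
    & forall a E, adjacency_matrix a -> sigma_matrix M E ->
        P (E `&` [set t | A t = a]) =
        (\int[P]_(t in E)
          (\prod_(i < n) \prod_(j < n | (i < j)%N)
             bernoulli_pmf (M t i j) (a i j))%:E)%E].

Definition frobenius_norm (X : 'M[R]_n) : R :=
  Num.sqrt (\sum_(i < n) \sum_(j < n) X i j ^+ 2).

Definition risk M A (Mhat : 'M[bool]_n -> 'M[R]_n) : \bar R :=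
  (((n%:R ^+ 2)^-1)%:E *
   'E_P[(fun t => frobenius_norm (Mhat (A t) - M t) ^+ 2)%R])%E.

End sampling.

(* Main.v *)
Require Import Defs.
From HB Require Import structures.
From mathcomp Require Import all_boot all_order all_algebra.
From mathcomp Require Import all_classical all_reals all_analysis.
From mathcomp Require Import measurable_realfun ring lra zify.
Import Order.TTheory GRing.Theory Num.Theory.
Import numFieldNormedType.Exports.
Set Implicit Arguments.
Unset Strict Implicit.
Unset Printing Implicit Defensive.
Local Open Scope classical_set_scope.
Local Open Scope ring_scope.

(** For each n one graphon of the class makes every estimator pay
    n^(-(2 alpha - 1)/(2 alpha)) up to a constant; since ln n >= ln 2, this
    dominates a constant times (n ln n)^(-(2 alpha - 1)/(2 alpha)).

    The graphon is W = q0 + om * sum_(l < k) phi_l phi_l, with k of order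
    n^(1/(2 alpha)) and om of order n^(-1/2), which is of order k^(-alpha).
    A vertex carries a group g in {0, .., k-1} and k sign bits r, all uniform and
    independent, and phi_l = (-1)^(r l) a_l(g), where a_l(g)^2 is (k + 1)/2 if
    g = l and 1/2 otherwise. The random signs make the phi_l orthogonal to the
    constant 1 and to one another, the two values of a_l give them norm 1, and
    sum_l phi_l^2 = k keeps W within om k of q0. So W has eigenvalues q0, om (k
    times) and 0, and these obey the prescribed decay
    ([block_graphon_class]). That the eigenfunctions extend to an orthonormal
    basis of L_2([0,1]) is Zorn's lemma ([orthonormal_extension]), started
    from these eigenfunctions and from infinitely many Rademacher functions of
    finer scale, so that the eigenvalue 0 can be listed infinitely often.

    Why no estimator can do well: fix i <> j and let l be the group of vertex j.
    Flipping bit l of vertex i preserves the uniform law of the labels. It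
    changes M i j by 2 om phi_l(xi_i) phi_l(xi_j), whose square is at least
    om^2 (k + 1). It changes the other entries M i m by
    2 om phi_l(xi_i) phi_l(xi_m), whose squares add up to O(n om^2) on average,
    because E phi_l^2 = 1 and phi_l^2 <= n; so by tensorization of the Hellinger
    affinity ([likelihood_overlap]) the two hypotheses remain indistinguishable
    from the graph as soon as n om^2 is small ([two_point_loss]).
    Hence each entry costs a constant times om^2 k ([pair_risk]), which is of
    order n^(-1 + 1/(2 alpha)).

    The analytic setting reduces to a finite one: all functions involved factor
    through the label of a point, which is uniform on a finite set, so that
    the risk is a finite sum over labels and graphs ([expectation_latents]). *)

(** * Step functions on the unit interval *)

Section step.
Variable R : realType.
Local Notation mu := (@lebesgue_measure R).

Definition cell (N : nat) (x : R) : nat := Num.truncn (N%:R * x).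

Lemma measurable_cell N : measurable_fun [set: R] (cell N).
Proof.
have mge q : measurable [set x : R | (q <= cell N x)%N].
  case: q => [|q]; first by rewrite (_ : [set _ | _] = setT)//; apply/seteqP; split.
  rewrite (_ : [set _ | _] = setT `&` ( *%R (N%:R : R)) @^-1` `[q.+1%:R, +oo[).
    by apply: mulrl_measurable => //; exact: measurable_itv.
  by apply/seteqP; split => [x|x [_]]; rewrite /= in_itv/= andbT /cell truncn_gt_nat.
move=> _ Y _; rewrite setTI.
rewrite (_ : _ @^-1` _ =
    \bigcup_(q in Y) ([set x | (q <= cell N x)%N] `\` [set x | (q.+1 <= cell N x)%N])).
  by apply: bigcup_measurable => q _; exact: measurableD.
apply/seteqP; split => [x Yx|x [q Yq /= [h1 h2]]].
  by exists (cell N x) => //=; rewrite leqnn ltnn.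
by rewrite /= (_ : cell N x = q) //; lia.
Qed.

Lemma measurable_step N (f : nat -> R) D : measurable_fun D (fun x => f (cell N x)).
Proof.
apply: measurable_funTS; apply: (measurableT_comp (f := f)); last exact: measurable_cell.
by move=> _ Y mY; rewrite setTI.
Qed.

(** Intervals of length 1/(N a) refine those of length 1/N, so every step
    function is also one of each finer scale. *)
Lemma cell_coarsen N a x : (0 < a)%N -> 0 <= x -> cell N x = (cell (N * a) x %/ a)%N.
Proof.
move=> a0 x0; apply/truncn_def.
have [/andP[h1 h2]] :
    (cell (N * a) x)%:R <= (N * a)%:R * x < (cell (N * a) x).+1%:R.
  by apply: truncn_itv; rewrite mulr_ge0.
have {}a0' : (0:R) < a%:R by rewrite ltr0n.
set c := cell _ _ in h1 h2 *.
rewrite -(ler_pM2r a0') -[in X in _ && X](ltr_pM2r a0').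
rewrite natrM mulrAC in h1 h2; rewrite -!natrM; apply/andP; split.
  by apply: le_trans h1; rewrite ler_nat leq_trunc_div.
by apply: (lt_le_trans h2); rewrite ler_nat -ltn_divLR.
Qed.

Lemma Rintegral_step N (f : nat -> R) : (0 < N)%N ->
  \int[mu]_(x in unit_itv) f (cell N x) = N%:R^-1 * \sum_(q < N) f q.
Proof.
move=> N0; have N0' : (0:R) < N%:R by rewrite ltr0n.
rewrite /unit_itv /Rintegral -integral_itv_bndo_bndc; last first.
  by apply/measurable_EFinP; exact: measurable_step.
rewrite -/(Rintegral _ _ _).
pose I (q : 'I_N) : set R := `[q%:R / N%:R, q.+1%:R / N%:R[%classic.
have Icell (q : 'I_N) x : 0 <= x -> I q x <-> cell N x = q.
  move=> x0; rewrite /I /= in_itv/= ler_pdivrMr// ltr_pdivlMr// mulrC.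
  have Nx : 0 <= N%:R * x by rewrite mulr_ge0.
  rewrite -truncn_eq// /cell; split; first by move/eqP.
  by move=> ->.
transitivity (\int[mu]_(x in `[0, 1[) (\sum_(q < N) f q * \1_(I q) x)).
  apply: eq_Rintegral => x; rewrite inE/= in_itv/= => /andP[x0 x1].
  have lt : (cell N x < N)%N.
    rewrite /cell truncn_lt_nat ?mulr_ge0//.
    by rewrite -[ltRHS]mulr1 ltr_pM2l.
  rewrite (bigD1 (Ordinal lt))//= big1 ?addr0.
    by rewrite indicE mem_set ?mulr1//; apply/Icell.
  move=> q qN; rewrite indicE memNset ?mulr0// => /Icell => /(_ x0) e.
  by move/eqP: qN; apply; apply/val_inj.
rewrite /Rintegral.
under eq_integral do rewrite -sumEFin.
have mI q : measurable (I q) by exact: measurable_itv.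
have iI (q : 'I_N) : mu.-integrable `[0, 1[ (EFin \o \1_(I q) : R -> \bar R).
  by apply: (@integrableS _ _ _ _ setT) => //; exact: integrable_indic_itv.
rewrite integral_sum//; last first.
  move=> q.
  exact: (@integrableZl _ _ _ mu `[0%R, 1%R[%classic (measurable_itv _) (f q) _ (iI q)).
have -> : (\sum_(q < N) \int[mu]_(x in `[0%R, 1%R[) (f q * \1_(I q) x)%:E =
    \sum_(q < N) (N%:R^-1 * f q)%:E)%E.
  apply: eq_bigr => q _; under eq_integral do rewrite EFinM.
  rewrite (@integralZl _ _ _ mu _ (measurable_itv _) _ (iI q) (f q)) integral_indic; last 2 first.
  - exact: measurable_itv.
  - exact: mI.
  have IS : I q `<=` `[0, 1[%classic.
    move=> x; rewrite /I /= !in_itv/= => /andP[h1 h2]; rewrite (le_trans _ h1)//=.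
    by apply: (lt_le_trans h2); rewrite ler_pdivrMr// mul1r ler_nat; exact: ltn_ord.
  transitivity ((f q)%:E * mu (I q))%E; first by congr (_ * mu _)%E; exact/setIidPl.
  rewrite /I lebesgue_measure_itv/= lte_fin ltr_pM2r ?invr_gt0// ltr_nat ltnSn.
  by rewrite -EFinB -EFinM; congr (_%:E); rewrite -mulrBl -natrB// subSnn mul1r mulrC.
by rewrite sumEFin /= mulr_sumr.
Qed.

End step.

(** * Orthonormal systems in L_2([0,1]) *)

Section orthonormal.
Variable R : realType.
Local Notation mu := (@lebesgue_measure R).
Implicit Types (f g : R -> R) (B S : set (R -> R)).

Lemma measurable_unit_itv : measurable (@unit_itv R : set (measurableTypeR R)).
Proof. exact: measurable_itv. Qed.

Lemma lebesgue_unit_itv : mu unit_itv = 1%:E.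
Proof. by rewrite /unit_itv lebesgue_measure_itv/= lte_fin ltr01 oppr0 adde0. Qed.

Lemma bounded_integrable f (c : R) : measurable_fun unit_itv f ->
  (forall x, unit_itv x -> `|f x| <= c) -> mu.-integrable unit_itv (EFin \o f).
Proof.
move=> mf fc; apply: (measurable_bounded_integrable measurable_unit_itv) => //.
  by have := ltry (1 : R); rewrite -lebesgue_unit_itv.
exists c; split; first exact: num_real.
by move=> M cM x Ix; apply: le_trans (fc _ Ix) (ltW cM).
Qed.

Lemma bounded_square_integrable f (c : R) : measurable_fun unit_itv f ->
  (forall x, unit_itv x -> `|f x| <= c) -> square_integrable f.
Proof.
move=> mf fc; split => //; apply: (@bounded_integrable (fun x => f x ^+ 2) (c ^+ 2)).
  exact: measurable_funX.
by move=> x Ix; rewrite normrX lerXn2r// ?nnegrE// ?(le_trans _ (fc _ Ix)) ?fc.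
Qed.

(** 2 |f g| <= f^2 + g^2. *)
Lemma integrable_inner f g : square_integrable f -> square_integrable g ->
  mu.-integrable unit_itv (EFin \o (fun x => f x * g x)).
Proof.
move=> [mf f2] [mg g2].
have := integrableD measurable_unit_itv f2 g2.
apply: (le_integrable measurable_unit_itv).
  by apply/measurable_EFinP; exact: measurable_funM.
move=> x Ix /=; rewrite lee_fin [leRHS]ger0_norm ?addr_ge0 ?sqr_ge0//.
have := sqr_ge0 (f x + g x); have := sqr_ge0 (f x - g x).
by move=> ? ?; rewrite ler_norml; apply/andP; split; nra.
Qed.

Lemma innerC f g : inner f g = inner g f.
Proof. by apply: eq_Rintegral => x _; rewrite mulrC. Qed.

Lemma innerZr c f g : square_integrable f -> square_integrable g ->
  inner f (fun x => c * g x) = c * inner f g.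
Proof.
move=> sf sg; rewrite -RintegralZl; last 2 first.
- exact: measurable_unit_itv.
- exact: integrable_inner.
by apply: eq_Rintegral => x _; rewrite mulrCA.
Qed.

Lemma square_integrableZ c f : square_integrable f -> square_integrable (fun x => c * f x).
Proof.
move=> [mf f2]; split; first exact: measurable_funM.
have := integrableZl measurable_unit_itv (c ^+ 2) f2.
by apply: eq_integrable => [|x _]; [exact: measurable_unit_itv|rewrite -EFinM exprMn].
Qed.

Lemma inner_ge0 f : 0 <= inner f f.
Proof. by apply: Rintegral_ge0 => x _; rewrite -expr2 sqr_ge0. Qed.

Lemma inner_eq0 f : square_integrable f -> inner f f = 0 ->
  {ae mu, forall x, unit_itv x -> f x = 0}.
Proof.
move=> sf; have [mf _] := sf; rewrite /inner /Rintegral => i0.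
have {i0} : (\int[mu]_(x in unit_itv) `|(f x ^+ 2)%:E| = 0)%E.
  transitivity (\int[mu]_(x in unit_itv) (f x * f x)%:E)%E.
    by apply: eq_integral => x _; rewrite /= ger0_norm ?sqr_ge0// expr2.
  rewrite -[LHS]fineK ?i0//.
  by apply: (integrable_fin_num measurable_unit_itv); exact: integrable_inner.
move=> /(ae_eq_integral_abs _ measurable_unit_itv) => h.
have {}h := h (proj2 (measurable_EFinP unit_itv (fun x => f x ^+ 2)) (measurable_funX 2 mf)).
by apply: filterS h => x /= h /h [] /eqP; rewrite sqrf_eq0 => /eqP.
Qed.

Definition orthonormal_set B :=
  [/\ B `<=` @square_integrable R,
      forall f, B f -> inner f f = 1
    & forall f g, B f -> B g -> f <> g -> inner f g = 0].

(** A maximal orthonormal set is complete: a nonzero function orthogonal to all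
    of it could be normalized and added. *)
Lemma orthonormal_extension S : orthonormal_set S ->
  exists B, S `<=` B /\ orthonormal_basis B.
Proof.
move=> oS.
have [F FP totF|A [oA maxA]] :=
    @Zorn_bigcup _ [set A | orthonormal_set (S `|` A)].
  have sub X : F X -> S `|` X `<=` S `|` \bigcup_(X in F) X.
    by move=> FX; apply: setUS; exact: bigcup_sup.
  have common f g : (S `|` \bigcup_(X in F) X) f -> (S `|` \bigcup_(X in F) X) g ->
      exists2 Y, orthonormal_set Y & Y f /\ Y g.
    move=> [Sf|[X FX Xf]] [Sg|[Y FY Yg]].
    - by exists S.
    - by exists (S `|` Y); [exact: FP|split; [left|right]].
    - by exists (S `|` X); [exact: FP|split; [right|left]].
    - have [XY|YX] := totF _ _ FX FY.
      + by exists (S `|` Y); [exact: FP|split; right => //; exact: XY].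
      + by exists (S `|` X); [exact: FP|split; right => //; exact: YX].
  split=> [f Bf|f Bf|f g Bf Bg].
  - by have [Y [oY _ _] [Yf _]] := common _ _ Bf Bf; exact: oY.
  - by have [Y [_ oY _] [Yf _]] := common _ _ Bf Bf; exact: oY.
  - by have [Y [_ _ oY] [Yf Yg]] := common _ _ Bf Bg; exact: oY.
exists (S `|` A); split; first exact: subsetUl.
case: (oA) => sqA oneA ortA; split => // f sf fA.
have [/inner_eq0|fn0] := eqVneq (inner f f) 0; first exact.
have f0 : 0 < inner f f by rewrite lt0r fn0 inner_ge0.
pose c := (Num.sqrt (inner f f))^-1; pose h x := c * f x.
have sh : square_integrable h by exact: square_integrableZ.
have fh : inner f h != 0.
  by rewrite innerZr// mulf_neq0// invr_neq0// gt_eqF// sqrtr_gt0.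
have hh : inner h h = 1.
  rewrite innerZr// innerC innerZr// mulrA -expr2 /c exprVn sqr_sqrtr ?mulVf//.
  exact: inner_ge0.
have gh g : (S `|` A) g -> inner g h = 0.
  by move=> Bg; rewrite innerZr ?(innerC g) ?fA ?mulr0//; exact: sqA.
exfalso; apply: (maxA (h |` A)).
  split; first by move=> g; right.
  move=> /(_ h (or_introl erefl)) Ah.
  by move/eqP: fh; apply; apply: fA; right.
have split_ g : (S `|` (h |` A)) g -> g = h \/ (S `|` A) g.
  by move=> [?|[->|?]]; [right; left|left|right; right].
split=> [g /split_[->|/sqA]//|g /split_[->|/oneA]//|g g'].
move=> /split_[->|Bg] /split_[->|Bg']//.
- by rewrite innerC gh.
- by rewrite gh.
- exact: ortA.
Qed.

End orthonormal.
Arguments measurable_unit_itv {R}.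

(** * Graphons of finite rank *)

Section finite_rank.
Variable R : realType.
Local Notation mu := (@lebesgue_measure R).

Lemma sum_ord_trunc (F : nat -> R) K n : (forall i, (K <= i)%N -> F i = 0) ->
  (K <= n)%N -> \sum_(i < n) F i = \sum_(i < K) F i.
Proof.
move=> F0 Kn; rewrite -(big_mkord xpredT F) -(big_mkord xpredT F) (@big_cat_nat _ _ _ K)//=.
by rewrite [X in _ + X]big_nat_cond [X in _ + X]big1 ?addr0// => i; rewrite andbT => /andP[/F0].
Qed.

(** All the series in the definition of the class are constant from rank K on,
    and the operator acts by f |-> sum_i omega_i <phi_i, f> phi_i, which vanishes
    on whatever the basis contains besides the phi_i. The system phi is infinite
    because the eigenvalue 0 has to be listed infinitely often. *)
Lemma finite_rank_graphon_class (C alpha : R) (omega : nat -> R)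
    (phi : nat -> R -> R) (c : nat -> R) (K : nat)
    (W := fun x y => \sum_(i < K) omega i * phi i x * phi i y) :
  (forall i, measurable_fun setT (phi i)) ->
  (forall i x, `|phi i x| <= c i) ->
  (forall i j, inner (phi i) (phi j) = (i == j)%:R) ->
  (forall i, (K <= i)%N -> omega i = 0) ->
  (forall i, `|omega i.+1| <= `|omega i|) ->
  polynomial_decay C alpha omega ->
  (forall x y, 0 <= W x y <= 1) ->
  graphon_class C alpha W.
Proof.
move=> mphi bphi ophi om0 decr decay W01.
have sphi i : square_integrable (phi i).
  by apply: (@bounded_square_integrable _ _ (c i)) => //; exact: measurable_funTS.
have tail k (F : nat -> R) : (K <= k)%N ->
    \sum_(i < k) omega i * F i = \sum_(i < K) omega i * F i.
  by move=> Kk; apply: (@sum_ord_trunc (fun i => omega i * F i)) => // i /om0->; rewrite mul0r.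
have WE k x y : (K <= k)%N -> \sum_(i < k) omega i * phi i x * phi i y = W x y.
  move=> Kk; rewrite -/(W x y) /W.
  under eq_bigr do rewrite -mulrA.
  under [RHS]eq_bigr do rewrite -mulrA.
  exact: (tail k (fun i => phi i x * phi i y)).
have opE f v : square_integrable f ->
    graphon_op W f v = \sum_(i < K) omega i * phi i v * inner (phi i) f.
  move=> sf; rewrite /graphon_op /W /Rintegral.
  have iphi i : mu.-integrable unit_itv (EFin \o (fun u => phi i u * f u)).
    exact: integrable_inner.
  transitivity (fine (\int[mu]_(u in unit_itv)
      (\sum_(i < K) (omega i * phi i v)%:E * (phi i u * f u)%:E))%E).
    congr fine; apply: eq_integral => u _.
    rewrite mulr_suml -sumEFin; apply: eq_bigr => i _; rewrite -EFinM.
    by congr EFin; ring.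
  rewrite integral_sum; last 2 first.
  - exact: measurable_unit_itv.
  - by move=> i; apply: integrableZl; [exact: measurable_unit_itv|exact: iphi].
  rewrite -[RHS]/(fine (_%:E)) -sumEFin; congr fine; apply: eq_bigr => i _.
  rewrite (integralZl measurable_unit_itv (iphi i)) [RHS]EFinM; congr (_ * _)%E.
  rewrite /inner /Rintegral fineK//.
  exact: (integrable_fin_num measurable_unit_itv (iphi i)).
split.
  split=> [|x y _ _|x y _ _]; last 2 first.
  - exact: W01.
  - by apply: eq_bigr => i _; rewrite -!mulrA [phi i x * _]mulrC.
  apply: measurable_funTS; apply: measurable_sum => i.
  apply: measurable_funM; first apply: measurable_funM => //.
  - exact: (measurableT_comp (mphi i) measurable_fst).
  - exact: (measurableT_comp (mphi i) measurable_snd).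
exists omega, phi; split => //.
- split => //.
  have [|B [phiB oB]] := @orthonormal_extension R (range phi).
    split=> [_ [i _ <-]//|_ [i _ <-]|_ _ [i _ <-] [j _ <-] ij].
      by rewrite ophi eqxx.
    by rewrite ophi; case: eqVneq ij => // ->.
  exists B; split=> // [i|i j eij|i|f Bf fphi].
  - by apply: phiB; exists i.
  - by have := ophi i j; rewrite eij ophi eqxx; case: eqVneq => // _ /eqP; rewrite oner_eq0.
  - apply: aeW => v _; rewrite opE//.
    under eq_bigr do rewrite ophi.
    have [iK|Ki] := ltnP i K.
      rewrite (bigD1 (Ordinal iK))//= eqxx mulr1 big1 ?addr0// => j ji.
      by rewrite (_ : (val j == i) = false) ?mulr0//; apply/negbTE.
    rewrite om0// mul0r big1// => j _.
    rewrite (_ : (val j == i) = false) ?mulr0//.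
    by apply/negbTE; rewrite neq_ltn (leq_trans (ltn_ord j)).
  - have [sB _ ort _] := oB.
    apply: aeW => v _; rewrite mul0r opE; last exact: sB.
    rewrite big1// => i _; rewrite ort ?mulr0//; first by apply: phiB; exists i.
    by move=> /esym; exact: fphi.
- suff h : series (fun i => `|omega i|) @ \oo --> \sum_(i < K) `|omega i|.
    exact: cvgP h.
  apply: cvg_near_cst; exists K => // k /= Kk; rewrite /series /= big_mkord.
  rewrite (@sum_ord_trunc (fun i => `|omega i|) K)// => i /om0->; exact: normr0.
- move=> x y _ _; apply: cvg_near_cst.
  by exists K => // k /= Kk; exact: WE.
- apply: cvg_near_cst; exists K => // k /= Kk.
  rewrite (eq_integral (cst 0%E)) ?integral0// => x _.
  rewrite (_ : \sum_(i < k) _ = W x x) ?subrr ?expr0n//.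
  by rewrite -(WE k)//; apply: eq_bigr => i _; rewrite expr2 mulrA.
Qed.

End finite_rank.

(** * Uniform labels *)

Section uniform_code.
Variables (R : realType) (F : finType) (z0 : F).
Local Notation mu := (@lebesgue_measure R).

(** On [0,1], the default z0 is reached only at x = 1. *)
Definition code (x : R) : F := nth z0 (enum F) (cell #|F| x).

Lemma card_code_gt0 : (0 < #|F|)%N.
Proof. by apply/card_gt0P; exists z0. Qed.

Lemma measurable_code (f : F -> R) D : measurable_fun D (fun x => f (code x)).
Proof. exact: (measurable_step #|F| (fun q => f (nth z0 (enum F) q))). Qed.

Lemma Rintegral_code (f : F -> R) :
  \int[mu]_(x in unit_itv) f (code x) = #|F|%:R^-1 * \sum_z f z.
Proof.
rewrite (@Rintegral_step _ _ (fun q => f (nth z0 (enum F) q))) ?card_code_gt0//.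
by congr (_ * _); rewrite -[RHS]big_enum (big_nth z0) -cardE big_mkord.
Qed.

(** The two halves of each interval of length 1/N carry opposite signs, while h
    takes the same value on both. *)
Lemma Rintegral_rademacher N (h : nat -> R) : (0 < N)%N ->
  \int[mu]_(x in unit_itv) ((-1) ^+ cell (N * 2) x * h (cell N x)) = 0.
Proof.
move=> N0.
transitivity (\int[mu]_(x in unit_itv)
    (fun q => (-1) ^+ q * h (q %/ 2)%N) (cell (N * 2) x)).
  apply: eq_Rintegral => x; rewrite inE /unit_itv /= in_itv /= => /andP[x0 _].
  by rewrite (@cell_coarsen _ N 2).
rewrite (@Rintegral_step _ _ (fun q => (-1) ^+ q * h (q %/ 2)%N)) ?muln_gt0 ?N0//.
rewrite (_ : \sum_(q < N * 2) _ = 0) ?mulr0// => {N0}.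
elim: N => [|N IHN]; first by rewrite mul0n big_ord0.
rewrite mulSn !big_ord_recr /= IHN add0r.
have -> : (N * 2 %/ 2 = N)%N by lia.
have -> : ((N * 2).+1 %/ 2 = N)%N by lia.
by rewrite exprS mulN1r mulNr subrr.
Qed.

End uniform_code.
Arguments measurable_code {R F} z0 f D.

(** * Groups and sign bits *)

Section features.
Variables (R : realType) (k : nat).

Definition latent : Type := ('I_k * {ffun 'I_k -> bool})%type.
HB.instance Definition _ := Finite.on latent.

(** The group of the vertex is amplified, by an amount that makes the mean square
    over the k groups equal to 1. *)
Definition feature (l : 'I_k) (z : latent) : R :=
  (-1) ^+ z.2 l * Num.sqrt (if z.1 == l then k.+1%:R / 2 else 2^-1).

Definition flip (l : 'I_k) (z : latent) : latent :=
  (z.1, [ffun m => if m == l then ~~ z.2 m else z.2 m]).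

Lemma flipK l : involutive (flip l).
Proof.
case=> g r; congr pair; apply/ffunP => m; rewrite !ffunE.
by case: eqP => //; rewrite negbK.
Qed.

Lemma feature_flip l m z :
  feature m (flip l z) = (if m == l then -1 else 1) * feature m z.
Proof.
rewrite /feature /flip /= ffunE; case: ifP => _; last by rewrite mul1r.
by rewrite signrN mulN1r mulNr.
Qed.

Lemma sqr_feature l z : feature l z ^+ 2 = if z.1 == l then k.+1%:R / 2 else 2^-1.
Proof.
rewrite /feature exprMn sqrr_sign mul1r sqr_sqrtr//.
by case: ifP; rewrite ?divr_ge0 ?invr_ge0.
Qed.

Lemma sum_sqr_feature z : \sum_l feature l z ^+ 2 = k%:R.
Proof.
under eq_bigr do rewrite sqr_feature.
rewrite (bigD1 z.1)//= eqxx (eq_bigr (fun=> 2^-1)); last first.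
  by move=> l; rewrite eq_sym => /negbTE ->.
rewrite sumr_const cardC1 card_ord.
have : (0 < k)%N by case: (z.1) => m /(leq_ltn_trans (leq0n m)).
by case: k => // k' _; rewrite /= -mulr_natr -[k'.+2]addn2 -[k'.+1]addn1 !natrD; lra.
Qed.

Lemma card_latent : #|{: latent}| = (k * 2 ^ k)%N.
Proof. by rewrite card_prod card_ffun !card_ord card_bool. Qed.

(** Flipping bit l changes the sign. *)
Lemma feature_mean0 l : \sum_z feature l z = 0.
Proof.
have : \sum_z feature l z = - \sum_z feature l z.
  rewrite [LHS](reindex_inj (inv_inj (flipK l))) -sumrN.
  by apply: eq_bigr => z _; rewrite feature_flip eqxx mulN1r.
by move=> ?; lra.
Qed.

Lemma feature_orthonormal l m :
  \sum_z feature l z * feature m z = #|{: latent}|%:R * (l == m)%:R.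
Proof.
have [<-|lm] := eqVneq l m; last first.
  rewrite mulr0.
  have : \sum_z feature l z * feature m z = - \sum_z feature l z * feature m z.
    rewrite [LHS](reindex_inj (inv_inj (flipK l))) -sumrN.
    apply: eq_bigr => z _; rewrite !feature_flip eqxx eq_sym (negbTE lm).
    by rewrite mulN1r mul1r mulNr.
  by move=> ?; lra.
under eq_bigr do rewrite -expr2 sqr_feature.
rewrite mulr1 -(pair_big xpredT xpredT (fun g (r : {ffun 'I_k -> bool}) =>
   if g == l then k.+1%:R / 2 else 2^-1 : R))/=.
under eq_bigr do rewrite sumr_const card_ffun card_bool card_ord.
rewrite sumrMnl -[LHS]mulr_natr card_latent natrM; congr (_ * _).
under eq_bigr => g _ do rewrite eq_sym.
rewrite -(sum_sqr_feature (l, [ffun=> true])).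
by apply: eq_bigr => g _; rewrite sqr_feature.
Qed.

Definition block_kernel (q0 om : R) (z w : latent) : R :=
  q0 + om * \sum_l feature l z * feature l w.

Lemma block_kernelC q0 om z w : block_kernel q0 om z w = block_kernel q0 om w z.
Proof. by congr (_ + _ * _); apply: eq_bigr => l _; rewrite mulrC. Qed.

(** |u v| <= (u^2 + v^2)/2, and the squared features of a label sum to k. *)
Lemma dist_block_kernel_le q0 om z w : 0 <= om -> `|block_kernel q0 om z w - q0| <= om * k%:R.
Proof.
move=> om0; rewrite /block_kernel addrC addKr normrM (ger0_norm om0) ler_wpM2l//.
have -> : k%:R = \sum_l (feature l z ^+ 2 + feature l w ^+ 2) / 2 :> R.
  by rewrite -mulr_suml big_split/= !sum_sqr_feature; lra.
apply: le_trans (ler_norm_sum _ _ _) _; apply: ler_sum => l _.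
rewrite ler_norml; have := sqr_ge0 (feature l z + feature l w).
have := sqr_ge0 (feature l z - feature l w).
by move=> ? ?; apply/andP; split; nra.
Qed.

Lemma feature_norm_le l z : `|feature l z| <= k.+1%:R.
Proof.
have k1 : (1 : R) <= k.+1%:R by rewrite ler1n.
rewrite -(@ler_sqr _ _ _) ?nnegrE// real_normK ?num_real// sqr_feature.
by case: ifP => _; nra.
Qed.

End features.

(** * The least favorable graphon *)

Section block_graphon.
Variables (R : realType) (k' : nat).
Local Notation k := k'.+1.
Local Notation mu := (@lebesgue_measure R).
Local Notation D := #|{: latent k}|.

Definition latent0 : latent k := (ord0, [ffun=> false]).

(** Indices above k are Rademacher functions on scales finer than that of the
    labels; they belong to the eigenvalue 0. *)
Definition eigenbasis (i : nat) (x : R) : R :=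
  if i == 0%N then 1
  else if (i <= k)%N then feature R (inord i.-1) (code latent0 x)
  else (-1) ^+ cell (D * 2 ^ (i - k)) x.

Let D0 : (0 < D)%N := card_code_gt0 latent0.

(** Seen from a Rademacher function of index N + 1 > k, all earlier functions are
    step functions of half its resolution. *)
Lemma eigenbasis_coarse i N : (i <= N)%N ->
  exists h : nat -> R, forall y, 0 <= y ->
    eigenbasis i y = h (cell (D * 2 ^ (N - k)) y).
Proof.
move=> iN; rewrite /eigenbasis.
case: (i == 0%N); first by exists (fun=> 1).
have [ik|ki] := leqP i k.
  exists (fun q => feature R (inord i.-1)
    (nth latent0 (enum {: latent k}) (q %/ 2 ^ (N - k)))) => // y y0.
  by rewrite /code (@cell_coarsen _ D (2 ^ (N - k))) ?expn_gt0.
exists (fun q => (-1) ^+ (q %/ 2 ^ (N - i))%N) => // y y0.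
rewrite (@cell_coarsen _ _ (2 ^ (N - i))) ?expn_gt0// -mulnA -expnD.
by rewrite addnC addnBA ?subnK// ltnW.
Qed.

Lemma eigenbasis_orthonormal i j :
  inner (eigenbasis i) (eigenbasis j) = (i == j)%:R.
Proof.
wlog ij : i j / (i <= j)%N.
  move=> H; have [|/ltnW] := leqP i j; first exact: H.
  by rewrite innerC eq_sym => /H.
have [kj|jk] := ltnP k j.
  have [->|neq] := eqVneq i j.
    transitivity (\int[mu]_(x in unit_itv) (cst 1 x : R)).
      apply: eq_Rintegral => x _; rewrite /= /eigenbasis gtn_eqF ?(leq_trans _ kj)//.
      by rewrite leqNgt kj/= -expr2 sqrr_sign.
    by rewrite (Rintegral_cst _ measurable_unit_itv) mul1r [X in fine X]lebesgue_unit_itv.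
  have {neq} ltij : (i < j)%N by rewrite ltn_neqAle neq.
  have [|h hE] := @eigenbasis_coarse i j.-1.
    by rewrite -ltnS prednK// (leq_ltn_trans _ ltij).
  rewrite innerC -[RHS](Rintegral_rademacher (N := D * 2 ^ (j.-1 - k)) h); last first.
    by rewrite muln_gt0 D0 expn_gt0.
  apply: eq_Rintegral => x; rewrite inE /unit_itv /= in_itv/= => /andP[x0 _].
  rewrite hE// /eigenbasis gtn_eqF ?(leq_trans _ kj)// leqNgt kj/=.
  by rewrite -mulnA -expnSr -subSn ?prednK//; lia.
have -> : inner (eigenbasis i) (eigenbasis j) = D%:R^-1 *
    \sum_z (if i == 0%N then 1 else feature R (inord i.-1 : 'I_k) z) *
           (if j == 0%N then 1 else feature R (inord j.-1 : 'I_k) z).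
  rewrite -(@Rintegral_code R _ latent0 (fun z =>
    (if i == 0%N then 1 else feature R (inord i.-1 : 'I_k) z) *
    (if j == 0%N then 1 else feature R (inord j.-1 : 'I_k) z))).
  by apply: eq_Rintegral => x _; rewrite /eigenbasis jk (leq_trans ij jk).
have DR : D%:R != 0 :> R by rewrite pnatr_eq0 -lt0n.
case: j ij jk => [|j] ij jk.
  move: ij; rewrite leqn0 => /eqP ->; rewrite eqxx.
  by under eq_bigr do rewrite mulr1; rewrite sumr_const mulVf.
case: i ij => [|i] ij /=.
  by under eq_bigr do rewrite mul1r; rewrite feature_mean0 mulr0.
rewrite feature_orthonormal mulKf//; congr (nat_of_bool _)%:R.
by rewrite -val_eqE /= !inordK ?eqSS// (leq_trans ij).
Qed.

Definition eigenvalue_seq (q0 om : R) (i : nat) : R :=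
  if i == 0%N then q0 else if (i <= k)%N then om else 0.

Lemma block_graphon_class (C alpha q0 om : R) :
  0 <= alpha -> 0 <= C -> 0 <= om <= q0 -> q0 <= C -> om * k%:R <= q0 ->
  q0 + om * k%:R <= 1 -> om <= C * k.+1%:R `^ (- alpha) ->
  graphon_class C alpha (fun x y => block_kernel q0 om (code latent0 x) (code latent0 y)).
Proof.
move=> a0 C0 /andP[om0 omq] qC omk1 omk2 omC.
have q00 : 0 <= q0 := le_trans om0 omq.
have WE : (fun x y => \sum_(i < k.+1) eigenvalue_seq q0 om i * eigenbasis i x * eigenbasis i y) =
    (fun x y => block_kernel q0 om (code latent0 x) (code latent0 y)).
  apply/funext => x; apply/funext => y; rewrite big_ord_recl /= !mulr1; congr (_ + _).
  rewrite mulr_sumr; apply: eq_bigr => l _.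
  rewrite /eigenvalue_seq /eigenbasis /= /bump leq0n add1n ltn_ord/= -mulrA.
  by rewrite (_ : inord l = l)//; apply/val_inj; rewrite /= inordK.
rewrite -WE; apply: (@finite_rank_graphon_class _ _ _ _ _ (fun=> k.+1%:R)).
- move=> i; rewrite /eigenbasis; case: (i == 0%N); first exact: measurable_cst.
  case: (i <= k)%N; first exact: (measurable_code latent0 (feature R (inord i.-1))).
  exact: (measurable_step _ (fun q => (-1) ^+ q)).
- move=> i x; rewrite /eigenbasis; case: ifP => _; first by rewrite normr1 ler1n.
  case: ifP => _; first exact: feature_norm_le.
  by rewrite normrX normrN1 expr1n ler1n.
- exact: eigenbasis_orthonormal.
- by move=> [|i] //= ki; rewrite /eigenvalue_seq leqNgt ki.
- move=> i; rewrite /eigenvalue_seq /=.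
  have [ik|ki] := ltnP i k; last by rewrite normr0.
  rewrite (ltnW ik) (ger0_norm om0); case: ifP => _; by rewrite ger0_norm.
- move=> i; rewrite /eigenvalue_seq; case: i => [|i] /=.
    by rewrite ger0_norm// powR1 mulr1.
  case: ifP => [ik|_]; last by rewrite normr0 mulr_ge0// powR_ge0.
  rewrite ger0_norm// (le_trans omC)// ler_wpM2l// !powRN lef_pV2 ?posrE ?powR_gt0//.
  by rewrite ge0_ler_powR ?nnegrE// ler_nat.
- move=> x y; have /= -> := congr1 (fun f => f x y) WE.
  have := dist_block_kernel_le q0 (code latent0 x) (code latent0 y) om0.
  by rewrite ler_distl => /andP[h1 h2]; apply/andP; split; lra.
Qed.

End block_graphon.

(** * The risk as a finite average *)

Section bayes_risk.
Context d (T : measurableType d) (R : realType) (P : probability T R) (n : nat).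
Variables (F : finType) (z0 : F) (w : F -> F -> R).
Variables (xi : 'I_n -> {RV P >-> R}) (A : T -> 'M[bool]_n).
Hypothesis xi_iid : iid_uniform01 xi.
Local Notation mu := (@lebesgue_measure R).
Local Notation W := (fun x y : R => w (code z0 x) (code z0 y)).
Local Notation M := (prob_matrix W xi).
Hypothesis genA : generated_adjacency P M A.

Definition latents (t : T) : {ffun 'I_n -> F} := [ffun i => code z0 (xi i t)].

Definition edge_matrix (z : {ffun 'I_n -> F}) : 'M[R]_n :=
  \matrix_(i, j) if i != j then w (z i) (z j) else 0.

Definition likelihood (m : 'M[R]_n) (a : 'M[bool]_n) : R :=
  \prod_(i < n) \prod_(j < n | (i < j)%N) bernoulli_pmf (m i j) (a i j).

Lemma prob_matrix_latents t : M t = edge_matrix (latents t).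
Proof. by apply/matrixP => i j; rewrite !mxE !ffunE. Qed.

Let cell_set z : set R := [set x | code z0 x = z].

Let measurable_cell_set z : measurable (cell_set z).
Proof.
have := measurable_code z0 (fun y => (y == z)%:R : R) setT measurableT [set 1] (measurable_set1 _).
rewrite setTI; congr measurable; apply/seteqP; split => x /=.
  by rewrite /cell_set /=; case: eqP => //= _ /eqP; rewrite eq_sym oner_eq0.
by move=> ->; rewrite eqxx.
Qed.

Let prob_cell_set i z : P (xi i @^-1` cell_set z) = (#|F|%:R^-1)%:E.
Proof.
have [_ unif _] := xi_iid; have := unif i _ (measurable_cell_set z).
rewrite /distribution /pushforward => ->.
have mI : measurable_fun setT (EFin \o (fun x : R => (code z0 x == z)%:R : R)).
  by apply/measurable_EFinP; exact: (measurable_code z0 (fun y => (y == z)%:R : R)).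
transitivity (\int[uniform_prob (@ltr01 R)]_x (EFin \o (fun x : R => (code z0 x == z)%:R : R)) x)%E.
  rewrite -[X in uniform_prob _ X]setIT -integral_indic//; last first.
    exact: measurable_cell_set.
  apply: eq_integral => x _; rewrite /= indicE; congr (_%:R%:E).
  by apply/esym; case: eqP => h; [rewrite mem_set|rewrite memNset].
rewrite integral_uniform//; last by move=> x; rewrite lee_fin.
rewrite subr0 invr1 mul1e.
rewrite -[LHS]fineK; last first.
  apply: (integrable_fin_num measurable_unit_itv).
  apply: (@bounded_integrable _ _ 1).
    exact: (measurable_code z0 (fun y => (y == z)%:R : R)).
  by move=> x _; case: eqP => _; rewrite ?normr1 ?normr0.
congr EFin; have := @Rintegral_code R F z0 (fun y => (y == z)%:R).
rewrite /Rintegral /unit_itv => ->.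
by rewrite (bigD1 z)//= eqxx big1 ?addr0 ?mulr1// => y /negbTE ->.
Qed.

Let latents_set z : [set t | latents t = z] =
  \bigcap_(i in [set: 'I_n]) xi i @^-1` cell_set (z i).
Proof.
apply/seteqP; split => t /=.
  by move=> <- i _; rewrite /cell_set /= ffunE.
by move=> h; apply/ffunP => i; rewrite ffunE; exact: h.
Qed.

Lemma measurable_latents z : measurable [set t | latents t = z].
Proof.
rewrite latents_set; apply: fin_bigcap_measurable => // i _.
by rewrite -[X in measurable X]setTI; exact: measurable_funPT.
Qed.

Lemma prob_latents z : P [set t | latents t = z] = (#|F|%:R^-1 ^+ n)%:E.
Proof.
have [_ _ ind] := xi_iid.
rewrite -[LHS]fineK ?fin_num_measure//; last exact: measurable_latents.
rewrite latents_set ind//; congr EFin.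
under eq_bigr do rewrite prob_cell_set.
by rewrite prodr_const card_ord.
Qed.

Let mset m : set T := [set t | M t = m].

Let sigma_mset m : sigma_matrix M (mset m).
Proof.
rewrite /sigma_matrix; set G := (X in <<s X >>).
rewrite (_ : mset m = \bigcap_(p in [set: 'I_n * 'I_n])
    [set t | M t p.1 p.2 = m p.1 p.2]); last first.
  apply/seteqP; split => t /=; first by move=> <-.
  by move=> h; apply/matrixP => i j; exact: (h (i, j)).
apply: (@fin_bigcap_measurable _ (g_sigma_algebraType G)) => // p _.
apply: sub_sigma_algebra; exists p => //; exists [set m p.1 p.2].
  exact: measurable_set1.
by rewrite setTI.
Qed.

Let measurable_mset m : measurable (mset m).
Proof.
rewrite (_ : mset m = \bigcup_(z in [set z | edge_matrix z = m]) [set t | latents t = z]).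
  by apply: fin_bigcup_measurable => // z _; exact: measurable_latents.
apply/seteqP; split => t; rewrite /mset /= prob_matrix_latents.
  by move=> h; exists (latents t).
by case=> z /= <- ->.
Qed.

Let integral_simple (I : Type) (s : seq I) (c : I -> R) (E : I -> set T) :
  (forall i, 0 <= c i) -> (forall i, measurable (E i)) ->
  (\int[P]_t (\sum_(i <- s) c i * \1_(E i) t)%:E =
   \sum_(i <- s) (c i)%:E * P (E i))%E.
Proof.
move=> c0 mE.
have mindic i : measurable_fun setT (fun t => (\1_(E i) t)%:E : \bar R).
  by apply/measurable_EFinP; exact: measurable_indic.
under eq_integral do rewrite -sumEFin.
rewrite ge0_integral_sum//; last 2 first.
- by move=> i; apply/measurable_EFinP; apply: measurable_funM.
- by move=> i t _; rewrite lee_fin mulr_ge0.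
apply: eq_bigr => i _; under eq_integral do rewrite EFinM.
by rewrite ge0_integralZl ?lee_fin// integral_indic// setIT.
Qed.

(** Distinct labellings can produce the same probability matrix, and the law of
    the graph is only prescribed conditionally on that matrix. *)
Lemma prob_mset m : P (mset m) =
  (\sum_z #|F|%:R^-1 ^+ n * (edge_matrix z == m)%:R)%:E.
Proof.
rewrite -[X in P X]setIT -integral_indic//.
transitivity (\int[P]_t (\sum_z (edge_matrix z == m)%:R *
    \1_[set t | latents t = z] t)%:E)%E.
  apply: eq_integral => t _; congr EFin.
  rewrite (bigD1 (latents t))//= big1 ?addr0; last first.
    by move=> z /eqP zt; rewrite [\1__ _]indicE memNset ?mulr0//= => /esym.
  rewrite [X in _ * X]indicE (mem_set (erefl : [set t0 | latents t0 = latents t] t)) mulr1 indicE.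
  case: eqP => h.
    by rewrite mem_set// /mset /= prob_matrix_latents.
  by rewrite memNset// /mset /= prob_matrix_latents.
rewrite integral_simple//; last by move=> z; exact: measurable_latents.
under eq_bigr do rewrite prob_latents -EFinM mulrC.
by rewrite sumEFin.
Qed.

Lemma bernoulli_pmf_ge0 (p : R) b : 0 <= p <= 1 -> 0 <= bernoulli_pmf p b.
Proof. by case: b => /andP[h1 h2] //=; rewrite subr_ge0. Qed.

Let prob_joint m a : adjacency_matrix a ->
  P (mset m `&` [set t | A t = a]) = ((likelihood m a)%:E * P (mset m))%E.
Proof.
move=> adja; have [_ _ h] := genA.
rewrite (h _ _ adja (sigma_mset m)).
transitivity (\int[P]_(t in mset m) (likelihood m a)%:E)%E.
  by apply: eq_integral => t; rewrite inE /mset /= => ->.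
by rewrite integral_cst.
Qed.

(** Both sides are decomposed along the finitely many values of the graph and of
    the probability matrix; on each piece the conditional law of the graph is the
    likelihood. *)
Lemma expectation_latents (g : 'M[bool]_n -> 'M[R]_n -> R) :
  (forall a m, 0 <= g a m) ->
  ('E_P[fun t => g (A t) (M t)])%E =
  (#|F|%:R^-1 ^+ n * \sum_z \sum_(a | `[< adjacency_matrix a >])
      likelihood (edge_matrix z) a * g a (edge_matrix z))%:E.
Proof.
move=> g0; have [adjA mA _] := genA.
pose S := undup [seq edge_matrix z | z <- enum {: {ffun 'I_n -> F}}].
have uS : uniq S by exact: undup_uniq.
have inS z : edge_matrix z \in S by rewrite mem_undup map_f// mem_enum.
pose J := [seq (a, m) | a <- enum {: 'M[bool]_n}, m <- S].
rewrite unlock.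
transitivity (\int[P]_t (\sum_(p <- J) g p.1 p.2 *
    \1_(mset p.2 `&` [set t | A t = p.1]) t)%:E)%E.
  apply: eq_integral => t _; congr EFin.
  rewrite big_allpairs big_enum/= (bigD1 (A t))//= [X in _ + X]big1 ?addr0; last first.
    move=> a /eqP aA; rewrite big1// => m _.
    by rewrite indicE memNset ?mulr0// => -[_ /= /esym].
  rewrite (bigD1_seq (M t))//=; last by rewrite prob_matrix_latents.
  rewrite big1 ?addr0; last first.
    move=> m /eqP mM.
    by rewrite indicE memNset ?mulr0// => -[/esym].
  by rewrite indicE mem_set ?mulr1.
rewrite integral_simple//; last by move=> p; exact: measurableI.
rewrite big_allpairs big_enum/= (bigID (fun a => `[< adjacency_matrix a >]))/=.
rewrite [X in (_ + X)%E]big1 ?adde0; last first.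
  move=> a /asboolPn nadj; rewrite big1// => m _.
  rewrite (_ : _ `&` _ = set0) ?measure0 ?mule0//.
  by apply/seteqP; split => t //= [_ /= At]; apply: nadj; rewrite -At.
rewrite [in RHS]exchange_big/= mulr_sumr -sumEFin; apply: eq_bigr => a /asboolP adja.
transitivity (\sum_(m <- S) (\sum_z #|F|%:R^-1 ^+ n *
   ((likelihood m a * g a m) * (edge_matrix z == m)%:R))%:E)%E.
  apply: eq_bigr => m _; rewrite prob_joint// prob_mset -!EFinM; congr EFin.
  by rewrite !mulr_sumr; apply: eq_bigr => z _; ring.
rewrite sumEFin exchange_big/= mulr_sumr; congr EFin; apply: eq_bigr => z _.
rewrite -mulr_sumr; congr (_ * _).
rewrite (bigD1_seq (edge_matrix z))//= eqxx mulr1 big1 ?addr0// => m.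
by rewrite eq_sym => /negbTE ->; rewrite mulr0.
Qed.

End bayes_risk.

(** * Two hypotheses and Hellinger affinity *)

Section two_point.
Variable R : realType.

(** The best u is the weighted mean of x and y, with loss
    (L L' / (L + L')) (x - y)^2; and L L' / (L + L') >= sqrt (L L') - (L + L')/4
    amounts to (sqrt (L L') - (L + L')/2)^2 >= 0. This form is linear in the
    affinity sqrt (L L'), so it can be summed over graphs. A lower bound c of
    (x - y)^2 takes its place because the left factor may be negative. *)
Lemma two_point_loss (L L' u x y c : R) : 0 <= L -> 0 <= L' -> 0 <= c ->
  c <= (x - y) ^+ 2 ->
  (Num.sqrt (L * L') - (L + L') / 4) * c <= L * (u - x) ^+ 2 + L' * (u - y) ^+ 2.
Proof.
move=> L0 L'0 c0 cxy; rewrite sqrtrM//.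
have [s0 s'0] := (sqrtr_ge0 L, sqrtr_ge0 L').
rewrite -{2 3}(sqr_sqrtr L0) -{2 3}(sqr_sqrtr L'0).
move: (Num.sqrt L) (Num.sqrt L') s0 s'0 => s s' s0 s'0.
have [S0|Spos] := leP (s ^+ 2 + s' ^+ 2) 0.
  have -> : s = 0 by nra.
  have -> : s' = 0 by nra.
  by nra.
rewrite -(ler_pM2l Spos).
have -> : (s ^+ 2 + s' ^+ 2) * (s ^+ 2 * (u - x) ^+ 2 + s' ^+ 2 * (u - y) ^+ 2) =
   (s ^+ 2 * (u - x) + s' ^+ 2 * (u - y)) ^+ 2 + (s * s') ^+ 2 * (x - y) ^+ 2 by ring.
have -> : (s ^+ 2 + s' ^+ 2) * ((s * s' - (s ^+ 2 + s' ^+ 2) / 4) * c) =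
   (s * s') ^+ 2 * c - (s * s' - (s ^+ 2 + s' ^+ 2) / 2) ^+ 2 * c by field.
have h1 : (s * s') ^+ 2 * c <= (s * s') ^+ 2 * (x - y) ^+ 2 by rewrite ler_wpM2l ?sqr_ge0.
have h2 : 0 <= (s * s' - (s ^+ 2 + s' ^+ 2) / 2) ^+ 2 * c by rewrite mulr_ge0 ?sqr_ge0.
have := sqr_ge0 (s ^+ 2 * (u - x) + s' ^+ 2 * (u - y)); lra.
Qed.

(** The gap between the two means is (sqrt p - sqrt q)^2 / 2, and
    (p - q)^2 = (sqrt p - sqrt q)^2 (sqrt p + sqrt q)^2 with
    (sqrt p + sqrt q)^2 >= 4 b. *)
Lemma sqrt_mul_ge (b p q : R) : 0 < b -> b <= p -> b <= q ->
  (p + q) / 2 - (p - q) ^+ 2 / (8 * b) <= Num.sqrt (p * q) <= (p + q) / 2.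
Proof.
move=> b0 bp bq.
have [p0 q0] : 0 <= p /\ 0 <= q by split; lra.
rewrite sqrtrM//.
have ubp : b <= Num.sqrt p ^+ 2 by rewrite sqr_sqrtr.
have ubq : b <= Num.sqrt q ^+ 2 by rewrite sqr_sqrtr.
have [s0 t0] := (sqrtr_ge0 p, sqrtr_ge0 q).
rewrite -{1 2 5}(sqr_sqrtr p0) -{1 2 5}(sqr_sqrtr q0).
move: (Num.sqrt p) (Num.sqrt q) s0 t0 ubp ubq => s t s0 t0 bs bt.
have st : b <= s * t.
  have h : b ^+ 2 <= (s * t) ^+ 2 by rewrite exprMn expr2; apply: ler_pM; lra.
  by rewrite -(@ler_sqr _ b) ?nnegrE ?mulr_ge0// ltW.
apply/andP; split; last by have := sqr_ge0 (s - t); nra.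
rewrite lerBlDr -lerBlDl ler_pdivlMr; last by lra.
have -> : (s ^+ 2 - t ^+ 2) ^+ 2 = (s - t) ^+ 2 * (s + t) ^+ 2 by ring.
have -> : ((s ^+ 2 + t ^+ 2) / 2 - s * t) * (8 * b) = (s - t) ^+ 2 * (4 * b) by field.
by apply: ler_wpM2l; [exact: sqr_ge0|nra].
Qed.

(** Hellinger affinity of two Bernoulli laws. *)
Definition affinity (p q : R) : R :=
  Num.sqrt (p * q) + Num.sqrt ((1 - p) * (1 - q)).

Lemma affinity_bounds (b p q : R) : 0 < b ->
  b <= p <= 1 - b -> b <= q <= 1 - b ->
  1 - (p - q) ^+ 2 / (4 * b) <= affinity p q <= 1.
Proof.
move=> b0 /andP[bp pb] /andP[bq qb]; rewrite /affinity.
have /andP[h1 h2] := sqrt_mul_ge b0 bp bq.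
have [bp' bq'] : b <= 1 - p /\ b <= 1 - q by split; lra.
have /andP[h3 h4] := sqrt_mul_ge b0 bp' bq'.
have e : (1 - p - (1 - q)) ^+ 2 = (p - q) ^+ 2 by ring.
have e2 : (p - q) ^+ 2 / (4 * b) = (p - q) ^+ 2 / (8 * b) + (p - q) ^+ 2 / (8 * b).
  by field; lra.
rewrite e in h3; rewrite e2; apply/andP; split; lra.
Qed.

Lemma prod_ge_one_minus_sum (I : Type) (s : seq I) (Q : pred I) (rho x : I -> R) :
  (forall i, Q i -> 0 <= rho i <= 1) -> (forall i, Q i -> 1 - rho i <= x i) ->
  1 - \sum_(i <- s | Q i) x i <= \prod_(i <- s | Q i) rho i.
Proof.
move=> r01 rx.
suff : 1 - \sum_(i <- s | Q i) x i <= \prod_(i <- s | Q i) rho i <= 1 /\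
       0 <= \prod_(i <- s | Q i) rho i by case => /andP[].
elim: s => [|i s [/andP[h1 h2] h3]]; first by rewrite !big_nil subr0 lexx ler01.
rewrite !big_cons; case: ifP => [Qi|_]; last by rewrite h1 h2.
have /andP[r0 r1] := r01 _ Qi; have xi := rx _ Qi.
split; last exact: mulr_ge0.
apply/andP; split; last by nra.
move: (\sum_(_ <- _ | _) _) (\prod_(_ <- _ | _) _) h1 h2 h3 => S p h1 h2 h3; nra.
Qed.

End two_point.

Section adjacency_sums.
Variables (R : realType) (n : nat).

Let of_upper (f : {ffun 'I_n * 'I_n -> bool}) : 'M[bool]_n :=
  \matrix_(i, j) (f (i, j) || f (j, i)).
Let to_upper (a : 'M[bool]_n) : {ffun 'I_n * 'I_n -> bool} :=
  [ffun p : 'I_n * 'I_n => (p.1 < p.2)%N && a p.1 p.2].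

(** Graphs correspond to functions on the pairs i < j, over which sums of
    products distribute. *)
Lemma sum_adjacency_prod (h : 'I_n -> 'I_n -> bool -> R) :
  \sum_(a | `[< adjacency_matrix a >]) \prod_(i < n) \prod_(j < n | (i < j)%N) h i j (a i j) =
  \prod_(i < n) \prod_(j < n | (i < j)%N) (h i j true + h i j false).
Proof.
rewrite [RHS](pair_big_dep xpredT (fun i j : 'I_n => (i < j)%N)
   (fun i j => h i j true + h i j false))/=.
transitivity (\prod_(p : 'I_n * 'I_n | (p.1 < p.2)%N) \sum_(b : bool) h p.1 p.2 b); last first.
  by apply: eq_bigr => p _; rewrite big_bool.
rewrite (big_distr_big false).
rewrite (reindex_onto of_upper to_upper); last first.
  move=> a /asboolP[aT a0]; apply/matrixP => i j; rewrite !mxE !ffunE /=.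
  have aji : a j i = a i j by rewrite -[in LHS]aT mxE.
  rewrite aji; case: (ltngtP i j) => //= [_|/ord_inj ->]; first by rewrite orbF.
  by rewrite a0.
have upperP f : (to_upper (of_upper f) == f) =
    (f \in pffun_on false (fun p : 'I_n * 'I_n => (p.1 < p.2)%N) predT).
  apply/eqP/pffun_onP => [<-|[supp _]].
    split; last by [].
    by apply/fintype.subsetP => p; rewrite !unfold_in /= ffunE; case: (_ < _)%N.
  have f0 (i j : 'I_n) : (i < j)%N = false -> f (i, j) = false.
    move=> ij; have := fintype.subsetP supp (i, j); rewrite !unfold_in /= ij.
    by case: (f (i, j)) => // /(_ isT).
  apply/ffunP => -[i j]; rewrite ffunE mxE /=.
  have [ij|/negbTE ij] := boolP (i < j)%N; last by rewrite f0.
  by rewrite (f0 j i) ?orbF//; apply/negbTE; rewrite -leqNgt ltnW.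
apply: eq_big => [f|f /andP[_ /eqP fE]].
  rewrite -upperP; case: eqP => fE; rewrite ?andbF// andbT; apply/asboolP; split.
    by apply/matrixP => i j; rewrite !mxE orbC.
  by move=> i; rewrite mxE orbb -fE ffunE /= ltnn.
rewrite pair_big_dep/=; apply: eq_bigr => p ij; rewrite mxE -surjective_pairing.
by rewrite -{2}fE ffunE /= ltnNge ltnW//= orbF.
Qed.

End adjacency_sums.

Section likelihoods.
Variables (R : realType) (n : nat).
Implicit Types (m : 'M[R]_n) (a : 'M[bool]_n).

Lemma sqrt_prod (I : Type) (s : seq I) (Q : pred I) (f : I -> R) :
  (forall i, Q i -> 0 <= f i) ->
  Num.sqrt (\prod_(i <- s | Q i) f i) = \prod_(i <- s | Q i) Num.sqrt (f i).
Proof.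
move=> f0; elim: s => [|i s IHs]; first by rewrite !big_nil sqrtr1.
by rewrite !big_cons; case: ifP => // Qi; rewrite sqrtrM ?IHs// f0.
Qed.

Lemma likelihood_ge0 m a :
  (forall i j : 'I_n, (i < j)%N -> 0 <= m i j <= 1) -> 0 <= likelihood m a.
Proof.
move=> m01; apply: prodr_ge0 => i _; apply: prodr_ge0 => j ij.
exact/bernoulli_pmf_ge0/m01.
Qed.

Lemma likelihood_sum1 m : \sum_(a | `[< adjacency_matrix a >]) likelihood m a = 1.
Proof.
rewrite (sum_adjacency_prod (fun i j => bernoulli_pmf (m i j))).
by rewrite big1// => i _; rewrite big1// => j _; rewrite /= addrC subrK.
Qed.

Lemma likelihood_affinity m m' :
  (forall i j : 'I_n, (i < j)%N -> 0 <= m i j <= 1) ->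
  (forall i j : 'I_n, (i < j)%N -> 0 <= m' i j <= 1) ->
  \sum_(a | `[< adjacency_matrix a >]) Num.sqrt (likelihood m a * likelihood m' a) =
  \prod_(i < n) \prod_(j < n | (i < j)%N) affinity (m i j) (m' i j).
Proof.
move=> m01 m'01.
rewrite -(sum_adjacency_prod (fun i j c =>
  Num.sqrt (bernoulli_pmf (m i j) c * bernoulli_pmf (m' i j) c))).
apply: eq_bigr => a _; rewrite -big_split/= sqrt_prod; last first.
  move=> i _; rewrite mulr_ge0//; apply: prodr_ge0 => j ij;
    by apply: bernoulli_pmf_ge0; [exact: m01 || exact: m'01].
apply: eq_bigr => i _; rewrite -big_split/= sqrt_prod// => j ij.
by rewrite mulr_ge0// bernoulli_pmf_ge0// ?m01 ?m'01.
Qed.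

(** Affinities multiply over independent edges, and a product of numbers
    1 - x in [0,1] is at least 1 minus the sum of the x. *)
Lemma likelihood_overlap m m' b : 0 < b ->
  (forall i j : 'I_n, (i < j)%N -> b <= m i j <= 1 - b) ->
  (forall i j : 'I_n, (i < j)%N -> b <= m' i j <= 1 - b) ->
  2^-1 - \sum_(i < n) \sum_(j < n | (i < j)%N) (m i j - m' i j) ^+ 2 / (4 * b) <=
  \sum_(a | `[< adjacency_matrix a >])
    (Num.sqrt (likelihood m a * likelihood m' a)
     - (likelihood m a + likelihood m' a) / 4).
Proof.
move=> b0 mb m'b.
have wk (x : R) : b <= x <= 1 - b -> 0 <= x <= 1.
  by move=> /andP[? ?]; apply/andP; split; lra.
rewrite big_split/= sumrN -mulr_suml big_split/= !likelihood_sum1.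
rewrite likelihood_affinity => [|i j /mb/wk//|i j /m'b/wk//].
rewrite !pair_big_dep/=.
have h := @prod_ge_one_minus_sum R _ (index_enum _) (fun p : 'I_n * 'I_n => (p.1 < p.2)%N)
  (fun p => affinity (m p.1 p.2) (m' p.1 p.2))
  (fun p => (m p.1 p.2 - m' p.1 p.2) ^+ 2 / (4 * b)).
have {}h := h _ _.
suff : 1 - \sum_(p : 'I_n * 'I_n | (p.1 < p.2)%N) (m p.1 p.2 - m' p.1 p.2) ^+ 2 / (4 * b)
  <= \prod_(p : 'I_n * 'I_n | (p.1 < p.2)%N) affinity (m p.1 p.2) (m' p.1 p.2) by lra.
apply: h => p pp; have /andP[h1 h2] := affinity_bounds b0 (mb _ _ pp) (m'b _ _ pp).
  by rewrite h2 andbT addr_ge0 ?sqrtr_ge0.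
by lra.
Qed.

End likelihoods.

(** * Bayes risk of one entry *)

Section resampling.
Variables (R : realType) (I F : finType).
Implicit Types (z : {ffun I -> F}) (i : I).

Definition resample z i x : {ffun I -> F} := [ffun m => if m == i then x else z m].

(** The pair (labelling, spare label) is mapped to itself bijectively by swapping
    the label of i with the spare one. *)
Lemma sum_resample (f : {ffun I -> F} -> R) i :
  \sum_z \sum_x f (resample z i x) = #|F|%:R * \sum_z f z.
Proof.
pose s (p : {ffun I -> F} * F) := (resample p.1 i p.2, p.1 i).
have sK : involutive s.
  case=> z x; rewrite /s /=; congr pair; last by rewrite ffunE eqxx.
  by apply/ffunP => m; rewrite !ffunE; case: eqP => [->|].
rewrite pair_big/= (reindex_inj (inv_inj sK))/=.
have sE p : resample (resample p.1 i p.2) i (p.1 i) = p.1 by case: p => z x; have [] := sK (z, x).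
under eq_bigr do rewrite sE.
rewrite -(pair_big xpredT xpredT (fun z (x : F) => f z))/= mulr_sumr.
by apply: eq_bigr => z _; rewrite sumr_const mulr_natl.
Qed.

End resampling.

Section pair_risk.
Variables (R : realType) (n k : nat) (q0 om b : R).
Local Notation F := (latent k).
Local Notation Z := {ffun 'I_n -> F}.
Local Notation w := (block_kernel q0 om).
Local Notation phi := (feature R).
Hypotheses (b0 : 0 < b) (k0 : (0 < k)%N) (kn : (k <= n)%N).
Hypothesis wb : forall x y : F, b <= w x y <= 1 - b.
(* The squared changes of the entries at vertex i have mean at most 12 n om^2 in
   total; divided by 2 b, this must not exceed 1/4. *)
Hypothesis info : 24 * (n%:R * om ^+ 2) <= b.
Variables (i j : 'I_n).
Hypothesis ij : i != j.

Lemma block_kernel_flip l (x y : F) : w x y - w (flip l x) y = 2 * om * (phi l x * phi l y).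
Proof.
rewrite /block_kernel opprD addrACA subrr add0r -mulrBr -sumrB (bigD1 l)//= big1 ?addr0.
  by rewrite feature_flip eqxx; ring.
by move=> m /negbTE ml; rewrite feature_flip ml mul1r subrr.
Qed.

(** Vertex j sees the bit of vertex i indexed by its own group most strongly; this
    is the bit that is flipped. *)
Definition flip_seen (z : Z) : Z := resample z i (flip (z j).1 (z i)).

Let flip_seen_i z : flip_seen z i = flip (z j).1 (z i).
Proof. by rewrite ffunE eqxx. Qed.

Let flip_seen_neq z m : m != i -> flip_seen z m = z m.
Proof. by move=> /negbTE mi; rewrite ffunE mi. Qed.

(** The flip leaves vertex j, hence the flipped index, unchanged. *)
Lemma flip_seenK : involutive flip_seen.
Proof.
move=> z; apply/ffunP => m; have [->|mi] := eqVneq m i.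
  by rewrite flip_seen_i (flip_seen_neq _ (m := j)) 1?eq_sym// flip_seen_i flipK.
by rewrite !flip_seen_neq.
Qed.

Let sqr_change (z : Z) (m : 'I_n) : R := 4 * om ^+ 2 * (phi (z j).1 (z i) ^+ 2 * phi (z j).1 (z m) ^+ 2).

Let edge_flip_i z m : m != i ->
  (edge_matrix w z i m - edge_matrix w (flip_seen z) i m) ^+ 2 = sqr_change z m.
Proof.
move=> mi; rewrite !mxE eq_sym mi flip_seen_i flip_seen_neq// block_kernel_flip /sqr_change; ring.
Qed.

Let edge_sym (z : Z) (a c : 'I_n) : edge_matrix w z a c = edge_matrix w z c a.
Proof. by rewrite !mxE eq_sym block_kernelC. Qed.

Let edge_flip_far (z : Z) (a c : 'I_n) : a != i -> c != i ->
  edge_matrix w z a c - edge_matrix w (flip_seen z) a c = 0.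
Proof. by move=> ai ci; rewrite !mxE !flip_seen_neq// subrr. Qed.

Let sqr_change_ge0 z m : 0 <= sqr_change z m.
Proof.
by rewrite /sqr_change; apply: mulr_ge0; apply: mulr_ge0 => //; exact: sqr_ge0.
Qed.

(** Only the pairs containing i are affected. In the sum over all ordered pairs
    each of them is counted twice, whence 2 b instead of 4 b. *)
Let pairs_le (z : Z) :
  \sum_(a < n) \sum_(c < n | (a < c)%N)
     (edge_matrix w z a c - edge_matrix w (flip_seen z) a c) ^+ 2 / (4 * b) <=
  (\sum_m sqr_change z m) / (2 * b).
Proof.
have b4 : 0 <= (4 * b)^-1 by rewrite invr_ge0 mulr_ge0// ltW.
have le (a c : 'I_n) : (a < c)%N ->
    (edge_matrix w z a c - edge_matrix w (flip_seen z) a c) ^+ 2 / (4 * b) <=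
    ((a == i)%:R * sqr_change z c + (c == i)%:R * sqr_change z a) / (4 * b).
  move=> ac; rewrite ler_wpM2r//.
  have [ai|ai] := eqVneq a i.
    have ci : c != i by rewrite -ai -val_eqE /= gtn_eqF.
    by rewrite (negbTE ci) mul0r addr0 mul1r ai edge_flip_i.
  rewrite mul0r add0r; have [ci|ci] := eqVneq c i.
    by rewrite mul1r ci edge_sym (edge_sym (flip_seen z)) edge_flip_i.
  by rewrite mul0r edge_flip_far// expr0n.
apply: (@le_trans _ _ (\sum_(a < n) \sum_(c < n)
    ((a == i)%:R * sqr_change z c + (c == i)%:R * sqr_change z a) / (4 * b))).
  apply: ler_sum => a _; rewrite [leRHS](bigID (fun c : 'I_n => (a < c)%N))/=.
  rewrite -[leLHS]addr0; apply: lerD; first by apply: ler_sum => c ac; exact: le.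
  apply: sumr_ge0 => c _; rewrite mulr_ge0//.
  by rewrite addr_ge0// mulr_ge0.
under eq_bigr do rewrite -mulr_suml.
rewrite -mulr_suml.
under eq_bigr do rewrite big_split/=.
rewrite big_split/= [X in X + _](bigD1 i)//= [X in _ + X + _]big1; last first.
  by move=> a /negbTE ->; under eq_bigr do rewrite mul0r; rewrite big1.
rewrite addr0 [X in _ + X]exchange_big/= [X in _ + X](bigD1 i)//=.
rewrite [X in _ + (_ + X)]big1; last first.
  by move=> a /negbTE ->; under eq_bigr do rewrite mul0r; rewrite big1.
rewrite addr0 eqxx; under eq_bigr do rewrite mul1r.
by rewrite le_eqVlt; apply/orP; left; apply/eqP; field; rewrite gt_eqF.
Qed.

Let card_neq0 : #|{: F}|%:R != 0 :> R.
Proof. by rewrite pnatr_eq0 -lt0n card_latent muln_gt0 k0 expn_gt0. Qed.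

Let sum_sqr (l : 'I_k) : \sum_(x : F) phi l x ^+ 2 = #|{: F}|%:R.
Proof.
by under eq_bigr do rewrite expr2; rewrite feature_orthonormal eqxx mulr1.
Qed.

Let sqr_feature_bounds (l : 'I_k) (x : F) : 2^-1 <= phi l x ^+ 2 <= n%:R.
Proof.
have kn' : k%:R <= n%:R :> R by rewrite ler_nat.
have k1 : 1 <= k%:R :> R by rewrite ler1n.
rewrite sqr_feature -[k.+1]addn1 natrD.
by case: ifP => _; apply/andP; split; lra.
Qed.

(** The label of i is independent of the group of j, and the features have mean
    square 1. *)
Let sum_seen : \sum_(z : Z) phi (z j).1 (z i) ^+ 2 = #|{: Z}|%:R.
Proof.
apply: (mulfI card_neq0); rewrite -(sum_resample _ i).
under eq_bigr => z _.
  under eq_bigr => x _ do rewrite !ffunE eqxx eq_sym (negbTE ij).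
  rewrite sum_sqr; over.
by rewrite sumr_const mulr_natr.
Qed.

Let sum_seen_neq (m : 'I_n) : m != i -> m != j ->
  \sum_(z : Z) phi (z j).1 (z i) ^+ 2 * phi (z j).1 (z m) ^+ 2 = #|{: Z}|%:R.
Proof.
move=> mi mj; rewrite -sum_seen.
apply: (mulfI card_neq0); rewrite -(sum_resample _ m) mulr_sumr.
apply: eq_bigr => z _.
under eq_bigr do rewrite !ffunE eqxx eq_sym (negbTE mj) eq_sym (negbTE mi).
by rewrite -mulr_sumr sum_sqr mulrC.
Qed.

(** Vertices other than i and j contribute 4 om^2 each by independence; for i and
    j the pointwise bound phi^2 <= n is enough, as only two terms are concerned. *)
Let sum_sqr_change_le : \sum_(z : Z) \sum_m sqr_change z m <= 12 * (n%:R * om ^+ 2) * #|{: Z}|%:R.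
Proof.
rewrite exchange_big/=.
apply: (@le_trans _ _ (\sum_m 4 * om ^+ 2 *
    ((1 + (m == i)%:R * n%:R + (m == j)%:R * n%:R) * #|{: Z}|%:R))).
  apply: ler_sum => m _; rewrite -mulr_sumr ler_wpM2l//; first by rewrite mulr_ge0 ?sqr_ge0.
  have crude : \sum_(z : Z) phi (z j).1 (z i) ^+ 2 * phi (z j).1 (z m) ^+ 2 <= n%:R * #|{: Z}|%:R.
    rewrite -sum_seen mulr_sumr; apply: ler_sum => z _.
    rewrite mulrC ler_wpM2r ?sqr_ge0//.
    by have /andP[] := sqr_feature_bounds (z j).1 (z m).
  have [mi|mi] := eqVneq m i.
    apply: le_trans crude _; rewrite ler_wpM2r// mul1r.
    by rewrite addrAC lerDr addr_ge0// mulr_ge0.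
  have [mj|mj] := eqVneq m j.
    by apply: le_trans crude _; rewrite ler_wpM2r// mul1r mul0r addr0 lerDr.
  by rewrite sum_seen_neq// !mul0r !addr0 mul1r.
rewrite -mulr_sumr -mulr_suml !big_split/=.
rewrite sumr_const card_ord.
rewrite (bigD1 i)//= eqxx mul1r big1 ?addr0; last by move=> m /negbTE ->; rewrite mul0r.
rewrite (bigD1 j)//= eqxx mul1r big1 ?addr0; last by move=> m /negbTE ->; rewrite mul0r.
by rewrite le_eqVlt; apply/orP; left; apply/eqP; ring.
Qed.

Let wb01 (z : Z) (a c : 'I_n) : (a < c)%N -> b <= edge_matrix w z a c <= 1 - b.
Proof. by move=> ac; rewrite mxE -val_eqE /= ltn_eqF//= wb. Qed.

(** Averaging over the labels z and over their flips is the same, so each label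
    may be paired with its flip and the pair bounded by [two_point_loss]. *)
Lemma pair_risk (u : 'M[bool]_n -> R) :
  om ^+ 2 * k.+1%:R / 8 * #|{: Z}|%:R <=
  \sum_(z : Z) \sum_(a | `[< adjacency_matrix a >])
     likelihood (edge_matrix w z) a * (u a - edge_matrix w z i j) ^+ 2.
Proof.
pose f (z : Z) := \sum_(a | `[< adjacency_matrix a >])
     likelihood (edge_matrix w z) a * (u a - edge_matrix w z i j) ^+ 2.
pose c : R := om ^+ 2 * k.+1%:R.
have c0 : 0 <= c by rewrite mulr_ge0 ?sqr_ge0.
rewrite -/f.
have lik0 (z : Z) a : 0 <= likelihood (edge_matrix w z) a.
  apply: likelihood_ge0 => p q /(wb01 z) /andP[h1 h2].
  by rewrite (le_trans (ltW b0) h1) (le_trans h2)// gerBl ltW.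
have local (z : Z) : c * (2^-1 - (\sum_m sqr_change z m) / (2 * b)) <= f z + f (flip_seen z).
  apply: (@le_trans _ _ (c * \sum_(a | `[< adjacency_matrix a >])
    (Num.sqrt (likelihood (edge_matrix w z) a * likelihood (edge_matrix w (flip_seen z)) a)
     - (likelihood (edge_matrix w z) a + likelihood (edge_matrix w (flip_seen z)) a) / 4))).
    rewrite ler_wpM2l//.
    apply: le_trans (likelihood_overlap b0 (wb01 z) (wb01 (flip_seen z))).
    by rewrite lerD2l lerN2 pairs_le.
  rewrite /f -big_split/= mulr_sumr; apply: ler_sum => a _; rewrite mulrC.
  apply: two_point_loss => //; rewrite edge_flip_i 1?eq_sym// /sqr_change /c.
  rewrite [phi _ (z j) ^+ 2]sqr_feature eqxx.
  have /andP[h _] := sqr_feature_bounds (z j).1 (z i).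
  have : 0 <= c * (phi (z j).1 (z i) ^+ 2 - 2^-1) by rewrite mulr_ge0// subr_ge0.
  by rewrite /c; move: (phi _ _ ^+ 2) (om ^+ 2) (k.+1%:R) => x y t; lra.
have double : \sum_z f z = (\sum_z (f z + f (flip_seen z))) / 2.
  have e : \sum_z f (flip_seen z) = \sum_z f z.
    by rewrite [RHS](reindex_inj (inv_inj flip_seenK)).
  by rewrite big_split/= e; lra.
rewrite double; apply: (@le_trans _ _ ((\sum_(z : Z) c * (2^-1 - (\sum_m sqr_change z m) / (2 * b))) / 2)).
  rewrite -mulr_sumr sumrB sumr_const -mulr_suml -/c.
  have hD : (\sum_z \sum_m sqr_change z m) / (2 * b) <= #|{: Z}|%:R / 4.
    rewrite ler_pdivrMr ?mulr_gt0//.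
    apply: le_trans sum_sqr_change_le _.
    rewrite mulrC -mulrA ler_wpM2l//.
    by move: (info) => info'; lra.
  have := ler_wpM2l c0 hD.
  rewrite -[2^-1 *+ _]mulr_natr; move: ((\sum_z \sum_m sqr_change z m) / (2 * b)) => S.
  by rewrite (_ : #|xpredT| = #|{: Z}|)//; lra.
by rewrite ler_wpM2r ?invr_ge0//; apply: ler_sum => z _; exact: local.
Qed.

End pair_risk.

(** * From one entry to the Frobenius norm *)

Lemma frobenius_norm_sqr (R : realType) n (X : 'M[R]_n) :
  frobenius_norm X ^+ 2 = \sum_(i < n) \sum_(j < n) X i j ^+ 2.
Proof.
by rewrite sqr_sqrtr//; apply: sumr_ge0 => i _; apply: sumr_ge0 => j _; exact: sqr_ge0.
Qed.

Lemma block_graphon_risk d (T : measurableType d) (R : realType)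
    (P : probability T R) (n k' : nat) (q0 om b : R)
    (xi : 'I_n -> {RV P >-> R}) (A : T -> 'M[bool]_n)
    (W := fun x y : R => block_kernel q0 om (code (latent0 k') x) (code (latent0 k') y))
    (Mhat : 'M[bool]_n -> 'M[R]_n) :
  (2 <= n)%N -> (k' < n)%N -> 0 < b ->
  (forall x y : latent k'.+1, b <= block_kernel q0 om x y <= 1 - b) ->
  24 * (n%:R * om ^+ 2) <= b ->
  iid_uniform01 xi -> generated_adjacency P (prob_matrix W xi) A ->
  ((om ^+ 2 * k'.+2%:R / 16)%:E <= risk P (prob_matrix W xi) A Mhat)%E.
Proof.
move=> n2 kn b0 wb info iid genA; rewrite /risk.
rewrite (expectation_latents iid genA
  (g := fun a m => frobenius_norm (Mhat a - m) ^+ 2)); last first.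
  by move=> a m; exact: sqr_ge0.
rewrite -EFinM lee_fin.
pose Z := ({ffun 'I_n -> latent k'.+1})%type.
have n0 : (0 : R) < n%:R by rewrite ltr0n; exact: leq_trans n2.
have cF : (0 : R) < #|{: latent k'.+1}|%:R.
  by rewrite ltr0n card_latent muln_gt0 expn_gt0.
have cZ : #|{: Z}|%:R = #|{: latent k'.+1}|%:R ^+ n :> R.
  by rewrite card_ffun card_ord natrX.
set c := om ^+ 2 * k'.+2%:R.
have c0 : 0 <= c by rewrite mulr_ge0 ?sqr_ge0.
have lik0 (z : Z) a : 0 <= likelihood (edge_matrix (block_kernel q0 om) z) a.
  apply: likelihood_ge0 => p q pq; rewrite mxE -val_eqE /= ltn_eqF//=.
  have /andP[h1 h2] := wb (z p) (z q).
  by rewrite (le_trans (ltW b0) h1) (le_trans h2)// gerBl ltW.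
have main : \sum_(i < n) \sum_(j < n | i != j) c / 8 * #|{: Z}|%:R <=
   \sum_(z : Z) \sum_(a | `[< adjacency_matrix a >])
      likelihood (edge_matrix (block_kernel q0 om) z) a *
      frobenius_norm (Mhat a - edge_matrix (block_kernel q0 om) z) ^+ 2.
  apply: (@le_trans _ _ (\sum_(i < n) \sum_(j < n | i != j)
      \sum_(z : Z) \sum_(a | `[< adjacency_matrix a >])
      likelihood (edge_matrix (block_kernel q0 om) z) a *
      (Mhat a i j - edge_matrix (block_kernel q0 om) z i j) ^+ 2)).
    apply: ler_sum => i _; apply: ler_sum => j ij.
    exact: (pair_risk b0 (ltn0Sn k') kn wb info ij (fun a => Mhat a i j)).
  under eq_bigr do rewrite exchange_big/=.
  rewrite exchange_big/=; apply: ler_sum => z _.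
  under eq_bigr do rewrite exchange_big/=.
  rewrite exchange_big/=; apply: ler_sum => a _.
  rewrite frobenius_norm_sqr mulr_sumr; apply: ler_sum => i _.
  rewrite mulr_sumr [leRHS](bigID (fun j => i != j))/=.
  under [X in _ <= X + _]eq_bigr do rewrite !mxE.
  under [X in X <= _]eq_bigr do rewrite mxE.
  by rewrite lerDl; apply: sumr_ge0 => j _; rewrite mulr_ge0 ?sqr_ge0.
have count : \sum_(i < n) \sum_(j < n | i != j) c / 8 * #|{: Z}|%:R =
    n%:R * (n%:R - 1) * (c / 8 * #|{: Z}|%:R).
  under eq_bigr => i _.
    rewrite sumr_const (@eq_card _ _ (predC1 i)); last first.
      by move=> j; rewrite !inE eq_sym.
    rewrite cardC1 card_ord; over.
  rewrite sumr_const card_ord -[LHS]mulr_natl -[X in _ * X]mulr_natl.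
  by rewrite -subn1 natrB ?(leq_trans _ n2)// mulrA.
rewrite count in main.
rewrite exprVn -cZ.
have cZ0 : (0 : R) < #|{: Z}|%:R by rewrite cZ exprn_gt0.
apply: (@le_trans _ _ ((n%:R ^+ 2)^-1 * (#|{: Z}|%:R^-1 *
    (n%:R * (n%:R - 1) * (c / 8 * #|{: Z}|%:R))))); last first.
  by rewrite !ler_wpM2l// invr_ge0 ltW ?exprn_gt0.
have n2' : (2 : R) <= n%:R by rewrite (ler_nat _ 2).
have -> : (n%:R ^+ 2)^-1 * (#|{: Z}|%:R^-1 *
    (n%:R * (n%:R - 1) * (c / 8 * #|{: Z}|%:R))) =
    c / 8 * (1 - n%:R^-1).
  by field; rewrite !gt_eqF.
have : n%:R^-1 <= 2^-1 :> R by rewrite lef_pV2 ?posrE.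
by move: (n%:R^-1) => y; nra.
Qed.

(** * Choice of the parameters *)

(** k is the integer part of n^(1/(2 alpha)), written as a successor because
    labels require a nonempty set of groups. *)
Lemma block_count (R : realType) (alpha : R) (n : nat)
    (y := n%:R `^ (1 / (2 * alpha))) :
  1 < alpha -> (0 < n)%N ->
  exists2 k' : nat, (k' < n)%N & k'.+1%:R <= y < k'.+2%:R.
Proof.
move=> a1 n0; have x1 : 1 <= n%:R :> R by rewrite ler1n.
have e0 : 0 <= 1 / (2 * alpha) by rewrite divr_ge0//; lra.
have e1 : 1 / (2 * alpha) <= 1 by rewrite ler_pdivrMr; lra.
have y1 : 1 <= y by rewrite -(powRr0 n%:R) ler_powR.
have k0 : (0 < Num.truncn y)%N by rewrite truncn_gt0.
have := truncn_itv (le_trans ler01 y1).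
rewrite -(prednK k0) => yk; exists (Num.truncn y).-1 => //.
rewrite -(ler_nat R); have /andP[h _] := yk; apply: (le_trans h).
exact: ler1_powR.
Qed.

Section tuning.
Variables (R : realType) (alpha C : R) (n k' : nat).
Hypotheses (a1 : 1 < alpha) (C0 : 0 < C) (n2 : (1 < n)%N).
Let x : R := n%:R.
Let y := x `^ (1 / (2 * alpha)).
Hypothesis ky : k'.+1%:R <= y < k'.+2%:R.

Definition base_density : R := Num.min C 1 / 2.
(** The first bound serves the spectral decay, the second one keeps W in [0,1]
    and the information n om^2 small. *)
Definition perturbation : R := Num.min (C * 2 `^ (- alpha)) (base_density / 8).
Definition small_eigenvalue : R := perturbation * x `^ (- 2^-1).

Let x1 : 1 <= x. Proof. by rewrite ler1n ltnW. Qed.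
Let x0 : 0 < x. Proof. exact: lt_le_trans x1. Qed.

Lemma base_density_gt0 : 0 < base_density.
Proof. by rewrite divr_gt0// lt_min C0 ltr01. Qed.

Lemma base_density_le : base_density <= C /\ base_density <= 2^-1.
Proof.
have h1 : Num.min C 1 <= C by rewrite ge_min lexx.
have h2 : Num.min C 1 <= 1 by rewrite ge_min lexx orbT.
have h0 := C0; split; rewrite /base_density; lra.
Qed.

Lemma perturbation_gt0 : 0 < perturbation.
Proof. by rewrite lt_min mulr_gt0 ?powR_gt0//= divr_gt0 ?base_density_gt0. Qed.

Lemma small_eigenvalue_ge0 : 0 <= small_eigenvalue.
Proof. by rewrite mulr_ge0 ?powR_ge0// ltW ?perturbation_gt0. Qed.

Let sqr_invsqrt : x `^ (- 2^-1) ^+ 2 = x^-1.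
Proof.
rewrite -powR_mulrn ?powR_ge0// -powRrM mulNr mulVf ?pnatr_eq0//.
by rewrite powR_inv1// ltW.
Qed.

Lemma information_small : 24 * (n%:R * small_eigenvalue ^+ 2) <= base_density / 2.
Proof.
rewrite exprMn sqr_invsqrt -/x [x * _]mulrCA mulfV ?gt_eqF// mulr1.
have [_ h] := base_density_le; have h0 := base_density_gt0; have p0 := perturbation_gt0.
have : perturbation <= base_density / 8 by rewrite ge_min lexx orbT.
by move: base_density perturbation h h0 p0 => q p; nra.
Qed.

Lemma small_eigenvalue_count :
  small_eigenvalue * k'.+1%:R <= base_density / 8.
Proof.
apply: (@le_trans _ _ perturbation); last by rewrite ge_min lexx orbT.
have p0 := perturbation_gt0.
rewrite -[leRHS]mulr1 -mulrA ler_pM2l//.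
rewrite powRN ler_pdivrMl ?powR_gt0// mulr1.
have /andP[h _] := ky; apply: (le_trans h); apply: ler_powR => //.
have h1 := a1.
by rewrite ler_pdivrMr; lra.
Qed.

(** k + 1 <= 2 n^(1/(2 alpha)), and (2 n^(1/(2 alpha)))^(-alpha) is
    2^(-alpha) n^(-1/2). *)
Lemma small_eigenvalue_decay :
  small_eigenvalue <= C * k'.+2%:R `^ (- alpha).
Proof.
have h1 := a1.
have /andP[h _] := ky.
have k1 : (1 : R) <= k'.+1%:R by rewrite ler1n.
have y0 : 0 < y by rewrite powR_gt0.
have k2y : k'.+2%:R <= 2 * y.
  by rewrite -[k'.+2]addn1 natrD; lra.
apply: (@le_trans _ _ (C * (2 * y) `^ (- alpha))); last first.
  rewrite ler_pM2l// !powRN lef_pV2 ?posrE ?powR_gt0 ?mulr_gt0//.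
  by rewrite ge0_ler_powR ?nnegrE ?mulr_ge0//; [lra|exact: ltW].
rewrite powRM//; last exact: ltW.
rewrite mulrA /small_eigenvalue; apply: ler_pM.
- by rewrite ltW// perturbation_gt0.
- exact: powR_ge0.
- by rewrite ge_min lexx.
- rewrite /y -powRrM le_eqVlt; apply/orP; left; apply/eqP; congr (_ `^ _).
  by field; rewrite gt_eqF//; lra.
Qed.

Lemma small_eigenvalue_energy :
  perturbation ^+ 2 * x `^ (- ((2 * alpha - 1) / (2 * alpha))) <=
  small_eigenvalue ^+ 2 * k'.+2%:R.
Proof.
rewrite exprMn sqr_invsqrt -[leRHS]mulrA ler_pM2l ?exprn_gt0 ?perturbation_gt0//.
have h1 := a1.
rewrite (_ : - ((2 * alpha - 1) / (2 * alpha)) = -1 + 1 / (2 * alpha)); last first.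
  by field; rewrite gt_eqF//; lra.
rewrite powRD; last by rewrite (gt_eqF x0) implybT.
rewrite powR_inv1; last exact: ltW.
by rewrite ler_pM2l ?invr_gt0//; have /andP[_ /ltW] := ky.
Qed.

End tuning.

Theorem theorem2 (R : realType) (alpha C : R) (halpha : 1 < alpha)
    (hC : 0 < C) :
  exists2 c : R, 0 < c &
    forall (n : nat), (2 <= n)%N ->
    forall (d : measure_display) (T : measurableType d) (P : probability T R)
      (xi : 'I_n -> {RV P >-> R}) (A : (R -> R -> R) -> T -> 'M[bool]_n),
    iid_uniform01 xi ->
    (forall W, graphon_class C alpha W ->
       generated_adjacency P (prob_matrix W xi) (A W)) ->
    ((c * (n%:R * ln n%:R) `^ (- ((2 * alpha - 1) / (2 * alpha))))%:E <=
     ereal_inf [set ereal_sup [set risk P (prob_matrix W xi) (A W) Mhat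
                              | W in graphon_class C alpha]
               | Mhat in [set: 'M[bool]_n -> 'M[R]_n]])%E.
Proof.
have ln2 : 0 < ln (2 : R) by rewrite ln_gt0// ltr1n.
pose s := (2 * alpha - 1) / (2 * alpha).
have s0 : 0 <= s by rewrite divr_ge0//; lra.
(* om^2 (k + 1) / 16 is at least perturbation^2 / 16 times n^-s; the last factor
   pays for the logarithm, through ln n >= ln 2. *)
pose c := perturbation alpha C ^+ 2 / 16 * ln 2 `^ s.
have pert0 := perturbation_gt0 alpha hC.
exists c; first by rewrite !mulr_gt0 ?powR_gt0 ?exprn_gt0// invr_gt0.
move=> n n2 d T P xi A iid gen.
have n0 : (0 < n)%N by exact: ltnW.
have [k' kn ky] := block_count halpha n0.
set q0 := base_density C; set om := small_eigenvalue alpha C n.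
have q00 : 0 < q0 := base_density_gt0 hC.
have [qC qhalf] : q0 <= C /\ q0 <= 2^-1 := base_density_le hC.
have om0 : 0 <= om := small_eigenvalue_ge0 alpha n hC.
have omk : om * k'.+1%:R <= q0 / 8 := small_eigenvalue_count halpha hC n2 ky.
have omq : om <= q0.
  have : om * 1 <= om * k'.+1%:R by rewrite ler_wpM2l// ler1n.
  by lra.
pose W := fun u v : R => block_kernel q0 om (code (latent0 k') u) (code (latent0 k') v).
have WC : graphon_class C alpha W.
  apply: block_graphon_class; try lra.
  exact: (small_eigenvalue_decay halpha hC n2 ky).
apply: le_ereal_inf_tmp => _ [Mhat _ <-].
apply: le_ereal_sup_tmp; exists (risk P (prob_matrix W xi) (A W) Mhat); first by exists W.
apply: (le_trans _ (block_graphon_risk (b := q0 / 2) Mhat n2 kn _ _ _ iid (gen _ WC))); first last.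
- exact: (information_small alpha hC n2).
- move=> u v; have := dist_block_kernel_le q0 u v om0.
  by rewrite ler_distl => /andP[h1 h2]; apply/andP; split; lra.
- by rewrite divr_gt0.
rewrite lee_fin.
have energy := small_eigenvalue_energy halpha hC n2 ky.
apply: (@le_trans _ _ (perturbation alpha C ^+ 2 / 16 * n%:R `^ (- s))); last first.
  by rewrite mulrAC ler_pM2r ?invr_gt0.
rewrite /c -mulrA ler_pM2l; last by rewrite mulr_gt0 ?exprn_gt0 ?invr_gt0.
have x0 : (0 : R) < n%:R by rewrite ltr0n.
have lnn : ln 2 <= ln n%:R :> R by rewrite ler_ln ?posrE// ler_nat.
have lnn0 : 0 < ln n%:R :> R by exact: lt_le_trans lnn.
rewrite powRM; [|exact: ltW|exact: ltW].
rewrite mulrCA ler_piMr ?powR_ge0// powRN ler_pdivrMr ?powR_gt0// mul1r.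
by rewrite ge0_ler_powR// ?nnegrE; exact: ltW.
Qed.
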